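(* Let $1\le k\le N-1$ and let $I_k\subset\mathbb{C}[x_1,\dots,x_N]$ be the ideal of all polynomials $p(x)$ such that $p(x)=0$ whenever $x_{i_1}=x_{i_2}=\dots=x_{i_{k+1}}$ for some indexes $1\le i_1<i_2<\dots<i_{k+1}\le N$. Then the function $$\frac{f}{\prod_{i<j}^N(x_i-x_j)^c}$$ is locally $L^2$-integrable on $\mathbb{R}^N$ for all $f\in I_k$ provided that $c\le \frac{1}{k+1}$.
   Context: Here $N\ge2$ and $k$ are integers and $c$ is a real number. A function $\Psi$ on $\mathbb{R}^N$ is locally $L^2$-integrable if every point of $\mathbb{R}^N$ has a neighbourhood $U$ with $\int_U|\Psi|^2\,dx<\infty$. Real powers of real linear forms are understood through absolute values, i.e. only $|\Psi|=|f|\prod_{i<j}|x_i-x_j|^{-c}$ matters. *)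

(* Defs.v *)
From HB Require Import structures.
From mathcomp Require Import all_boot all_order all_algebra.
From mathcomp Require Import all_classical all_reals all_analysis.
From mathcomp Require Import complex.
From mathcomp Require mpoly.

Set Implicit Arguments.
Unset Strict Implicit.
Unset Printing Implicit Defensive.

Import Order.TTheory GRing.Theory Num.Theory.
Import numFieldNormedType.Exports.

Local Open Scope classical_set_scope.
Local Open Scope ring_scope.

(* The module mpoly cannot be imported together with mathcomp-analysis (their
   notations clash), so its two notations needed here are restated. *)
Notation "{ 'mpoly' T [ n ] }" := (mpoly.mpoly n T).
Notation "p .@[ v ]" := (mpoly.meval v p).

(* R^n is n.-tuple R. The library gives it the product sigma-algebra but no
   topology; it receives the one of 'rV[R]_n. *)
HB.instance Definition _ (n : nat) (T : topologicalType) :=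
  Topological.copy (n.-tuple T)
    (initial_topology (fun t : n.-tuple T => \row_i tnth t i)).

Section lebesgue_measure_tuple.
Context {R : realType}.
Local Notation T := (measurableTypeR R).

Definition cons_pair n (p : T * n.-tuple T) : n.+1.-tuple T :=
  [tuple of p.1 :: p.2].

(* R^(m+1) is identified with R x R^m, and R^0 carries the unit mass;
   lebesgue_measure_tuple_box below gives the expected volume of boxes. *)
Fixpoint lebesgue_measure_tuple (n : nat) : set (n.-tuple T) -> \bar R :=
  match n with
  | 0 => \d_([tuple] : 0.-tuple T)
  | m.+1 => pushforward (@lebesgue_measure R \x @lebesgue_measure_tuple m)%E
                        (@cons_pair m)
  end.
#[global] Arguments lebesgue_measure_tuple n : clear implicits.

Lemma measurable_cons_pair n :
  measurable_fun [set: T * n.-tuple T] (@cons_pair n).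
Proof. exact: measurable_cons. Qed.

Let uncons n (t : n.+1.-tuple T) :
  T * n.-tuple T := (thead t, [tuple of behead t]).

Let measurable_uncons n : measurable_fun setT (@uncons n).
Proof.
apply/measurable_fun_pairP; split; last exact: measurable_behead.
exact: measurable_tnth.
Qed.

Let cons_pairK n : cancel (@cons_pair n) (@uncons n).
Proof.
by move=> [x t]; rewrite /uncons/cons_pair/= theadE; congr pair; exact/val_inj.
Qed.

Let lebesgue_measure_tuple_spec n :
  exists m : {sigma_finite_measure set (n.-tuple T) -> \bar R},
    (m : set _ -> \bar R) = lebesgue_measure_tuple n.
Proof.
elim: n => [|n [m mE]]; first by exists \d_([tuple] : 0.-tuple T).
pose l := (@lebesgue_measure R \x m)%E.
pose mu : {measure set (n.+1.-tuple T) -> \bar R} :=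
  measure_function_pushforward__canonical__measure_function_Measure l
    (@measurable_cons_pair n).
have sf : sigma_finite setT mu.
  have /sigma_finiteP[F [FT ndF Foo]] := sigma_finiteT (@lebesgue_measure R).
  have /sigma_finiteP[G [GT ndG Goo]] := sigma_finiteT m.
  exists (fun k => @uncons n @^-1` (F k `*` G k)).
    rewrite -preimage_bigcup (_ : \bigcup_k _ = setT) ?preimage_setT//.
    rewrite -subTset => -[x y] _.
    have [i _ Fx] : (\bigcup_k F k) x by rewrite -FT.
    have [j _ Gy] : (\bigcup_k G k) y by rewrite -GT.
    exists (maxn i j) => //; split.
      by move: x Fx; exact/subsetPset/ndF/leq_maxl.
    by move: y Gy; exact/subsetPset/ndG/leq_maxr.
  move=> k; have [mF Fk] := Foo k; have [mG Gk] := Goo k.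
  have mFG : measurable (F k `*` G k) by exact: measurableX.
  split; first by rewrite -[X in measurable X]setTI; exact: measurable_uncons.
  rewrite /mu/= /pushforward -comp_preimage.
  rewrite (_ : _ \o _ = id); last by apply/funext => p; exact: cons_pairK.
  by rewrite preimage_id /l product_measure1E// lte_mul_pinfty// ge0_fin_numE.
pose M := Measure_isSigmaFinite.Build _ _ _ mu sf.
pose nu : {sigma_finite_measure set (n.+1.-tuple T) -> \bar R} :=
  HB.pack (Measure.sort mu) (Measure.class mu) M.
by exists nu; rewrite /= -mE.
Qed.

Let lebesgue_measure_tuple0 n : lebesgue_measure_tuple n set0 = 0%E.
Proof. by have [m <-] := lebesgue_measure_tuple_spec n; exact: measure0. Qed.

Let lebesgue_measure_tuple_ge0 n A : (0 <= lebesgue_measure_tuple n A)%E.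
Proof. by have [m <-] := lebesgue_measure_tuple_spec n; exact: measure_ge0. Qed.

Let lebesgue_measure_tuple_sigma_additive n :
  semi_sigma_additive (lebesgue_measure_tuple n).
Proof.
by have [m <-] := lebesgue_measure_tuple_spec n; exact: measure_semi_sigma_additive.
Qed.

HB.instance Definition _ n := isMeasure.Build _ _ _ (lebesgue_measure_tuple n)
  (@lebesgue_measure_tuple0 n) (@lebesgue_measure_tuple_ge0 n)
  (@lebesgue_measure_tuple_sigma_additive n).

Let lebesgue_measure_tuple_sigma_finite n :
  sigma_finite setT (lebesgue_measure_tuple n).
Proof. by have [m <-] := lebesgue_measure_tuple_spec n; exact: sigma_finiteT. Qed.

HB.instance Definition _ n := Measure_isSigmaFinite.Build _ _ _
  (lebesgue_measure_tuple n) (@lebesgue_measure_tuple_sigma_finite n).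

Lemma measurable_box n (A : 'I_n -> set T) : (forall i, measurable (A i)) ->
  measurable [set t : n.-tuple T | forall i, A i (tnth t i)].
Proof.
move=> mA; rewrite (_ : mkset _ =
    \bigcap_(i in [set: 'I_n]) ((fun t : n.-tuple T => tnth t i) @^-1` A i)).
  apply: fin_bigcap_measurable => [|i _]; first exact: finite_finset.
  by rewrite -[X in measurable X]setTI; exact: measurable_tnth.
by apply/seteqP; split => [t At i _|t At i]; [exact: At|exact: (At i)].
Qed.

Lemma lebesgue_measure_tuple_box n (a b : 'I_n -> R) : (forall i, a i <= b i) ->
  lebesgue_measure_tuple n [set t | forall i, a i <= tnth t i <= b i] =
  (\prod_i (b i - a i))%:E.
Proof.
elim: n a b => [|n IH] a b ab.
  by rewrite big_ord0/= diracE mem_set//= => -[].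
rewrite big_ord_recl EFinM -(IH (a \o lift ord0) (b \o lift ord0)) => [/=|i];
  last exact: ab.
have -> : (b ord0 - a ord0)%:E = lebesgue_measure (`[a ord0, b ord0] : set R).
  rewrite lebesgue_measure_itv/= lte_fin EFinB.
  by case: ltgtP (ab ord0) => // ->; rewrite -EFinB subrr.
rewrite /pushforward -product_measure1E//; last first.
  pose A (i : 'I_n) : set T := `[a (lift ord0 i), b (lift ord0 i)]%classic.
  rewrite (_ : mkset _ = [set t : n.-tuple T | forall i, A i (tnth t i)]).
    by apply: measurable_box => i; exact: measurable_itv.
  by apply/seteqP; split => t /= + i => /(_ i); rewrite /A/= in_itv.
congr (product_measure1 _ _ _); apply/seteqP; split => -[x t] /=.
  move=> H; split; first by rewrite in_itv/=; exact: (H ord0).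
  by move=> i; move: (H (lift ord0 i)); rewrite tnthS.
move=> [x01 H] i; have [j ->|->] := unliftP ord0 i; first by rewrite tnthS.
by move: x01; rewrite in_itv.
Qed.

End lebesgue_measure_tuple.
#[global] Arguments lebesgue_measure_tuple R n : clear implicits.

Section locally_L2.
Context {R : realType}.

(* Library integrals of non-measurable functions are defined but meaningless;
   measurability of U and integrability (which includes measurability of |Psi|^2
   on U) are therefore part of the definition. *)
Definition locally_L2 (N : nat) (Psi : N.-tuple R -> R[i]) : Prop :=
  forall a : N.-tuple R, exists U : set (N.-tuple (measurableTypeR R)),
    [/\ nbhs a U, measurable U &
        (lebesgue_measure_tuple R N).-integrable U
          (fun x => (Normc.normc (Psi x) ^+ 2)%:E)].

End locally_L2.

(* The points x range over all of C^N, not only over real points; the strictly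
   increasing s is the choice of indices i_1 < ... < i_(k+1). *)
Definition equal_coord_ideal (C : fieldType) (N k : nat) : set {mpoly C[N]} :=
  [set p | forall (s : 'I_k.+1 -> 'I_N) (x : 'I_N -> C),
     {homo s : a b / (a < b)%N} -> (forall a b, x (s a) = x (s b)) ->
     p.@[x] = 0].
#[global] Arguments equal_coord_ideal C N k : clear implicits.

(* f / \prod_(i < j) |x_i - x_j|^c. On the hyperplanes x_i = x_j, where the
   quotient may be undefined, the conventions 0 `^ c = (c == 0)%:R and 0^-1 = 0
   give it a value; these hyperplanes form a null set. *)
Definition vandermonde_quotient (R : realType) (N : nat) (c : R)
    (f : {mpoly R[i][N]}) (x : N.-tuple R) : R[i] :=
  f.@[fun i => (tnth x i)%:C%C] /
  (\prod_(i < N) \prod_(j < N | (i < j)%N) `|tnth x i - tnth x j| `^ c)%:C%C.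

(* Main.v *)
From mathcomp Require Import all_boot all_order all_algebra.
From mathcomp Require Import fingroup perm boolp ring lra zify.
From mathcomp Require mpoly.

Set Implicit Arguments.
Unset Strict Implicit.
Unset Printing Implicit Defensive.

Import Order.TTheory GRing.Theory Num.Theory.
Local Open Scope ring_scope.

(** On a box, [|Psi|^2] is dominated pointwise by an explicit integrable function.
    Sort the coordinates and expand [f] in the gaps [t_l] between consecutive
    ones. For a monomial that occurs, the degree in the gaps of a block of [n]
    consecutive points is at least [n (n - k) / (2 k)]: the component of [f] of
    this degree is homogeneous and vanishes when [k + 1] points of the block
    coincide, and the degree of such a polynomial is bounded below by induction
    on [n], restricting it to a largest flat [x_S = z] on which it does not
    vanish and taking the leading coefficient in [z]. For [c <= 1 / (k + 1)] these
    exponents outweigh the negative powers of [|x_i - x_j|] on every block, which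
    leaves [|Psi|^2 <= C \prod_l t_l^(-a)] with [a = k / (k + 1) < 1]. By the
    triangle inequality, this product along a path through the points is at most
    a multiple of [\prod_i (1 + \sum_(j > i) |x_i - x_j|^(-a))], whatever the
    order of the points on the line; here the variables can be integrated one
    after the other. *)

(** * Degrees of polynomials vanishing on equal coordinates *)

Section polynomials.
Import mpoly.
Context {K : numFieldType}.

Lemma poly_eq0_horner (p : {poly K}) : (forall z, p.[z] = 0) -> p = 0.
Proof.
move=> p0; apply/eqP/negPn/negP => pN0.
have U : uniq [seq (i%:R : K) | i <- iota 0 (size p)].
  rewrite map_inj_uniq ?iota_uniq// => i j /eqP.
  by rewrite eqr_nat => /eqP.
have /(max_poly_roots pN0)/(_ U) : all (root p) [seq (i%:R : K) | i <- iota 0 (size p)].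
  by apply/allP => x _; apply/eqP/p0.
by rewrite size_map size_iota ltnn.
Qed.

Lemma digits_inj n (d : nat) (u v : 'I_n -> nat) :
  (forall i, u i < d)%N -> (forall i, v i < d)%N ->
  (\sum_i u i * d ^ i = \sum_i v i * d ^ i)%N -> u =1 v.
Proof.
elim: n u v => [|n IH] u v ud vd; first by move=> _ [].
rewrite !big_ord_recl !expn0 !muln1.
have E (w : 'I_n.+1 -> nat) : (\sum_(i < n) w (lift ord0 i) * d ^ lift ord0 i =
    (\sum_(i < n) w (lift ord0 i) * d ^ i) * d)%N.
  rewrite big_distrl /=; apply: eq_bigr => i _.
  by rewrite /bump leq0n add1n expnSr mulnA.
rewrite !E => e.
have d0 : (0 < d)%N by apply: leq_trans (ud ord0).
have e0 : u ord0 = v ord0.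
  move: (congr1 (modn^~ d) e).
  by rewrite /= ![(_ ord0 + _)%N]addnC !modnMDl !modn_small.
have e1 : forall i, u (lift ord0 i) = v (lift ord0 i).
  apply: IH => //.
  by move/eqP: e; rewrite e0 eqn_add2l eqn_pmul2r// => /eqP.
by move=> i; have [j ->|->] := unliftP ord0 i.
Qed.

(* Kronecker's substitution [X_i := X^(d^i)] with [d] larger than the degree. *)
Lemma mpoly_eq0_meval n (p : {mpoly K[n]}) : (forall x, p.@[x] = 0) -> p = 0.
Proof.
move=> p0; pose d := msize p.
pose code (m : 'X_{1..n}) := (\sum_i m i * d ^ i)%N.
pose P : {poly K} := \sum_(m <- msupp p) p@_m *: 'X^(code m).
have P0 : P = 0.
  apply: poly_eq0_horner => z; rewrite -(p0 (fun i => z ^+ (d ^ i))) mevalE.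
  rewrite /P horner_sum; apply: eq_bigr => m _.
  rewrite hornerZ hornerXn; congr (_ * _); rewrite /code -prodrXr.
  by apply: eq_bigr => i _; rewrite mulnC exprM.
have small (m : 'X_{1..n}) i : m \in msupp p -> (m i < d)%N.
  move=> /msize_mdeg_lt; apply: leq_ltn_trans.
  by rewrite mdegE (bigD1 i)//= leq_addr.
apply/mpolyP => m; rewrite mcoeff0; apply/eqP/negPn/negP => pm.
have sm : m \in msupp p by rewrite mcoeff_msupp.
move: (congr1 (fun q : {poly K} => q`_(code m)) P0).
rewrite /= coef0 coef_sum (bigD1_seq m) ?msupp_uniq//= coefZ coefXn eqxx mulr1.
rewrite big_seq_cond big1 ?addr0 => [m0|m' /andP[sm' mm']].
  by rewrite m0 eqxx in pm.
rewrite coefZ coefXn; case: eqP => [e|_]; last by rewrite mulr0.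
move/eqP: mm' => []; apply/mnmP => i; symmetry.
by apply: (digits_inj _ _ e) => j; exact: small.
Qed.

Lemma mpoly_neq0_meval n (p : {mpoly K[n]}) : p != 0 -> exists x, p.@[x] != 0.
Proof.
move=> pN0; apply: contrapT => H; move/eqP: pN0; apply.
apply: mpoly_eq0_meval => x; apply/eqP/negPn/negP => px; apply: H.
by exists x.
Qed.

Lemma mpolyX_eq n (i j : 'I_n) : ('X_i == 'X_j :> {mpoly K[n]}) = (i == j).
Proof.
apply/eqP/eqP => [/(congr1 (mcoeff U_(i)))|->//].
rewrite !mcoeffXU eqxx; case: eqP => // _ /eqP.
by rewrite oner_eq0.
Qed.

(** Multiplying [p] by all differences ['X_i - 'X_j] keeps it nonzero, and a point where this
    product does not vanish has distinct coordinates. *)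
Lemma mpoly_neq0_meval_inj n (p : {mpoly K[n]}) : p != 0 ->
  exists2 x, injective x & p.@[x] != 0.
Proof.
move=> p0; pose v : {mpoly K[n]} :=
  \prod_(i < n) \prod_(j < n | j != i) ('X_i - 'X_j).
have v0 : v != 0.
  rewrite /v; apply/prodf_neq0 => i _; apply/prodf_neq0 => j ji.
  by rewrite subr_eq0 mpolyX_eq eq_sym.
have [|x] := @mpoly_neq0_meval n (p * v); first by rewrite mulf_neq0.
rewrite mevalM mulf_eq0 negb_or => /andP[px vx]; exists x => // i j xij.
apply/eqP/negPn/negP => ij; move/negP: vx; apply; apply/eqP.
rewrite /v rmorph_prod (bigD1 i)//= rmorph_prod (bigD1 j) 1?eq_sym//=.
by rewrite mevalB !mevalXU xij subrr !mul0r.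
Qed.

Definition deg_on n (A : {set 'I_n}) (m : 'X_{1..n}) := (\sum_(i in A) m i)%N.

Lemma coef_sum_deg_on n (p : {mpoly K[n]}) (A : {set 'I_n}) (w : 'X_{1..n} -> K) j :
  (\sum_(m <- msupp p) w m *: 'X^(deg_on A m))`_j =
  \sum_(m <- msupp p | deg_on A m == j) w m.
Proof.
rewrite coef_sum big_mkcond /= [RHS]big_mkcond /=; apply: eq_bigr => m _.
by rewrite coefZ coefXn eq_sym; case: eqP; rewrite ?mulr1 ?mulr0.
Qed.

(** * Restriction of a polynomial to a flat [x_S = z] *)

Section collapse.
Context {n : nat} (p : {mpoly K[n]}) (S : {set 'I_n}).

Definition collapse (x : 'I_n -> K) (z : K) i := if i \in S then z else x i.

Definition monom_off (m : 'X_{1..n}) : 'X_{1..n} :=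
  [multinom if i \in S then 0%N else m i | i < n].

(** This is the coefficient of [z ^ j] in the restriction of [p] to the flat [x_S = z], kept as a
    polynomial in the remaining variables so that the induction in [deg_vanishing] can be applied to
    it. *)
Definition collapse_coef j : {mpoly K[n]} :=
  \sum_(m <- msupp p | deg_on S m == j) p@_m *: 'X_[monom_off m].

Definition collapse_poly x : {poly K} :=
  \sum_(m <- msupp p) (p@_m * \prod_(i | i \notin S) x i ^+ m i) *: 'X^(deg_on S m).

Lemma horner_collapse_poly x z : (collapse_poly x).[z] = p.@[collapse x z].
Proof.
rewrite mevalE horner_sum; apply: eq_bigr => m _.
rewrite hornerZ hornerXn -mulrA; congr (_ * _).
rewrite [RHS](bigID (mem S)) /= mulrC; congr (_ * _).
  rewrite -prodrXr; apply: eq_bigr => i iS.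
  by rewrite /collapse iS.
by apply: eq_bigr => i /negbTE iS; rewrite /collapse iS.
Qed.

Lemma coef_collapse_poly x j : (collapse_poly x)`_j = (collapse_coef j).@[x].
Proof.
rewrite coef_sum_deg_on raddf_sum; apply: eq_bigr => m _ /=.
rewrite mevalZ mevalX; congr (_ * _).
rewrite [RHS](bigID (mem S)) /= [X in _ = X * _]big1 ?mul1r => [|i iS].
  by apply: eq_bigr => i /negbTE iS; rewrite mnmE iS.
by rewrite mnmE iS expr0.
Qed.

(** A monomial of this coefficient comes from a monomial of [p] of degree [j] in [S] by deleting the
    variables in [S], and degrees in [B] split over [S] and [B :\: S]. *)
Lemma deg_on_collapse_coef j m (B : {set 'I_n}) d : S \subset B ->
  (forall m, p@_m != 0 -> (deg_on B m <= d)%N) ->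
  (collapse_coef j)@_m != 0 -> (j + deg_on (B :\: S) m <= d)%N.
Proof.
move=> SB pd qm; have [m' [pm' Sm' ->]] : exists m',
    [/\ p@_m' != 0, deg_on S m' = j & m = monom_off m'].
  apply: contrapT => H; move/negP: qm; apply; apply/eqP.
  rewrite raddf_sum big_seq_cond big1//= => m' /andP[sm' /eqP jm'].
  rewrite mcoeffZ mcoeffX; case: eqP => [e|_]; last by rewrite mulr0.
  by case: H; exists m'; rewrite -mcoeff_msupp sm'.
apply: leq_trans (pd _ pm'); rewrite -Sm' /deg_on.
rewrite [leqRHS](big_setID S) /= (setIidPr SB) leq_add2l.
by apply: leq_sum => i; rewrite inE mnmE; case: ifP.
Qed.

End collapse.

(* Let [S] be a maximal subset of [B] such that [p] does not vanish on the flat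
   [x_S = z]. As a polynomial in [z], the restriction of [p] to this flat has the
   roots [x_i], [i] in [B \ S], and its leading coefficient vanishes whenever
   [k + 1] coordinates in [B \ S] coincide. *)
Lemma deg_vanishing k n (B : {set 'I_n}) d (p : {mpoly K[n]}) : p != 0 ->
  (forall m, p@_m != 0 -> (deg_on B m <= d)%N) ->
  (forall (T : {set 'I_n}) x, T \subset B -> #|T| = k.+1 ->
    {in T &, forall i j, x i = x j} -> p.@[x] = 0) ->
  (#|B| * (#|B| - k) <= k.*2 * d)%N.
Proof.
have [b] := ubnP #|B|; elim: b B d p => // b IH B d p Bb p0 pd pT.
have [Bk|kB] := leqP #|B| k; first by move: Bk; rewrite -subn_eq0 => /eqP->; rewrite muln0.
pose nz (S : {set 'I_n}) := [&& S \subset B, S != finset.set0 &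
  `[< exists x, {in S &, forall i j, x i = x j} /\ p.@[x] != 0 >]].
have [i0 i0B] : exists i, i \in B by apply/card_gt0P/(leq_ltn_trans _ kB).
have nz0 : nz [set i0].
  apply/and3P; split; first by rewrite sub1set.
    by rewrite -card_gt0 cards1.
  have [x px] := mpoly_neq0_meval p0.
  by apply/asboolP; exists x; split=> // i j; rewrite !inE => /eqP-> /eqP->.
have [S /maxsetP[/and3P[SB S0 /asboolP[x0 [x0S px0]]] maxS] _] := maxset_exists nz0.
have Sk : (#|S| <= k)%N.
  rewrite leqNgt; apply/negP => kS.
  have [s /andP[]] : exists T : {set 'I_n}, (T \subset S) && (#|T| == k.+1).
    have /card_gt0P[T] : (0 < #|[set T : {set 'I_n} | T \subset S & #|T| == k.+1]|)%N.
      by rewrite cards_draws bin_gt0.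
    by rewrite inE => ?; exists T.
  move=> sS /eqP sk; move/negP: px0; apply; apply/eqP; apply: (pT s) => //.
    exact: subset_trans SB.
  by move=> i j /(subsetP sS) iS /(subsetP sS) jS; exact: x0S.
have S1 : (0 < #|S|)%N by rewrite card_gt0.
pose q j := collapse_coef p S j.
have [s1 s1S] : exists i, i \in S by apply/set0Pn.
(* Collapsing [x0] to the common value [x0 s1] of its coordinates in [S] gives [x0] back, where [p]
   is nonzero. *)
have [j0 qj0] : exists j, q j != 0.
  apply: contrapT => H; move/negP: px0; apply; apply/eqP.
  rewrite (_ : p.@[x0] = (collapse_poly p S x0).[x0 s1]).
    rewrite (_ : collapse_poly p S x0 = 0) ?horner0//.
    apply/polyP => j; rewrite coef_collapse_poly coef0.
    have -> : collapse_coef p S j = 0 by apply/eqP/negPn/negP => e; apply: H; exists j.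
    exact: meval0.
  rewrite horner_collapse_poly; apply: meval_eq => i; rewrite /collapse.
  by case: ifP => // iS; exact: x0S.
have qd j : q j != 0 -> (j <= d)%N.
  move=> /mpoly_neq0_meval[x qx].
  have [m qm] : exists m, (q j)@_m != 0.
    apply: contrapT => H; move/negP: qx; apply; apply/eqP.
    have -> : q j = 0; last exact: meval0.
    apply/mpolyP => m; rewrite mcoeff0; apply/eqP/negPn/negP => e.
    by apply: H; exists m.
  exact: leq_trans (leq_addr _ _) (deg_on_collapse_coef SB pd qm).
have [j qj maxj] := ex_maxnP (ex_intro (fun j => q j != 0) j0 qj0) qd.
(* A nonzero value here would make [l |: S] admissible, against the maximality of [S]. *)
have zero x z : (exists2 l, l \in B :\: S & x l = z) -> p.@[collapse S x z] = 0.
  move=> [l]; rewrite inE => /andP[lS lB] xl.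
  apply/eqP/negPn/negP => H; have := maxS (l |: S).
  rewrite subsetUr => /(_ _ isT) e; move/negP: lS; apply.
  rewrite -e ?setU11//; apply/and3P; split.
  - by rewrite finset.subUset sub1set lB.
  - by rewrite -card_gt0; apply/card_gt0P; exists l; rewrite setU11.
  - apply/asboolP; exists (collapse S x z); split => // u v.
    have E w : w \in l |: S -> collapse S x z w = z.
      by rewrite !inE /collapse => /orP[/eqP ->|->]//; case: ifP.
    by move=> /E-> /E->.
(* At a point with distinct coordinates where the leading coefficient is nonzero, the polynomial in
   [z] has degree [j] and the distinct roots [x l], [l] in [B :\: S]. *)
have jB : (#|B :\: S| <= j)%N.
  have [x xI qx] := mpoly_neq0_meval_inj qj.
  have P0 : collapse_poly p S x != 0.
    apply/eqP => e; move: qx; rewrite -coef_collapse_poly e coef0.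
    by rewrite eqxx.
  have sP : (size (collapse_poly p S x) <= j.+1)%N.
    apply/leq_sizeP => i ji; rewrite coef_collapse_poly.
    have -> : collapse_coef p S i = 0.
      by apply/eqP/negPn/negP => /maxj; rewrite leqNgt ji.
    exact: meval0.
  have U : uniq [seq x i | i <- enum (B :\: S)] by rewrite map_inj_uniq ?enum_uniq.
  have /(max_poly_roots P0)/(_ U) :
      all (root (collapse_poly p S x)) [seq x i | i <- enum (B :\: S)].
    apply/allP => _ /mapP[l + ->]; rewrite mem_enum => lB.
    by apply/eqP; rewrite horner_collapse_poly; apply: zero; exists l.
  by rewrite size_map -cardE => H; rewrite -ltnS; exact: leq_trans sP.
have BS : #|B :\: S| = (#|B| - #|S|)%N by rewrite cardsD (setIidPr SB).
have SB' : (#|S| <= #|B|)%N by exact: subset_leq_card.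
have jd := qd _ qj.
have : (#|B :\: S| * (#|B :\: S| - k) <= k.*2 * (d - j))%N.
  apply: (IH _ _ (q j)) => // [|m qm|T x TB Tk xT]; first by rewrite BS; lia.
  - by have := deg_on_collapse_coef SB pd qm; lia.
  - rewrite -coef_collapse_poly (_ : collapse_poly p S x = 0) ?coef0//.
    apply: poly_eq0_horner => z; rewrite horner_collapse_poly; apply: (pT T) => //.
      exact: subset_trans TB (subsetDl _ _).
    have E w : w \in T -> collapse S x z w = x w.
      by move=> /(subsetP TB); rewrite inE /collapse => /andP[/negbTE->].
    by move=> u v uT vT; rewrite !E//; exact: xT.
rewrite BS in jB *; clear - kB Sk S1 SB' jB jd; move: #|B| #|S| k kB Sk S1 SB' jB jd => {}b s {}k kB sk s1 sb jb jd.
rewrite -muln2.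
(* If [k <= b - s], then [b(b-k) - (b-s)(b-s-k) = s(2b-s-k)] is at most [2k(b-s) <= 2kj], the
   difference being [(k-s)(2b-s) >= 0]. Otherwise [b <= 2k], while [b - k <= b - s <= d]. *)
have [c1|c1] := leqP k (b - s).
  have [u bE] : exists u, b = (k + s + u)%N by exists (b - s - k)%N; lia.
  have [v kE] : exists v, k = (s + v)%N by exists (k - s)%N; lia.
  have -> : (b - s = k + u)%N by lia.
  have -> : (b - k = s + u)%N by lia.
  have -> : (k + u - k = u)%N by lia.
  have [w dE] : exists w, d = (j + w)%N by exists (d - j)%N; lia.
  have -> : (d - j = w)%N by lia.
  have : (k + u <= j)%N by lia.
  by rewrite bE dE kE; nia.
move=> _; have : (b - s <= d)%N by lia.
have [u bE] : exists u, b = (k + u)%N by exists (b - k)%N; lia.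
have [v kE] : exists v, k = (s + v)%N by exists (k - s)%N; lia.
have [w dE] : exists w, s = (u + w)%N by exists (s - u)%N; lia.
have -> : (b - k = u)%N by lia.
have -> : (b - s = v + u)%N by lia.
by move=> H; have: (k * 2 * (v + u) <= k * 2 * d)%N; [rewrite leq_mul2l H orbT|nia].
Qed.

(* The coordinates [y_l] are the gaps between the consecutive points
   [y_0 + ... + y_i]. *)
Definition point n (y : 'I_n.+1 -> K) (i : 'I_n.+1) :=
  \sum_(l < n.+1 | (l <= i)%N) y l.

Definition ord_prev n (l : 'I_n.+1) : 'I_n.+1 := inord l.-1.

Lemma ord_prevE n (l : 'I_n.+1) : ord_prev l = l.-1 :> nat.
Proof. by rewrite inordK// (leq_ltn_trans (leq_pred l)). Qed.

Lemma point_prev n (y : 'I_n.+1 -> K) (l : 'I_n.+1) : (0 < l)%N ->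
  point y l = y l + point y (ord_prev l).
Proof.
move=> l0; rewrite /point (bigD1 l)//=; congr (_ + _); apply: eq_bigl => i.
by rewrite ord_prevE -(inj_eq val_inj) /=; lia.
Qed.

Lemma card_ord_itv n (a b : 'I_n.+1) : (a <= b)%N ->
  #|[set l : 'I_n.+1 | (a <= l <= b)%N]| = (b - a).+1.
Proof.
move=> ab; rewrite -sum1dep_card -subSn// -[RHS]muln1 -sum_nat_const_nat.
rewrite (big_nat_widenl a 0)// (big_nat_widen 0 b.+1 n.+1)// big_mkord.
by apply: eq_bigl => i; rewrite ltnS.
Qed.

(** * Scaling the gaps of a block of consecutive points *)

Section gaps.
Context {n : nat} (a b : 'I_n.+1).

Definition gapset := [set l : 'I_n.+1 | (a < l <= b)%N].

Definition gap_scale (y : 'I_n.+1 -> K) s l := if l \in gapset then s * y l else y l.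

(** Scaling the gaps of the block dilates its points about the first one; hence points of the block
    that coincide still do so after the scaling. *)
Lemma point_gap_scale y s (i : 'I_n.+1) : (a <= i <= b)%N ->
  point (gap_scale y s) i = point y a + s * (point y i - point y a).
Proof.
move=> /andP[ai ib]; rewrite /point.
rewrite (bigID (fun l : 'I_n.+1 => (l <= a)%N)) /=.
rewrite [X in _ = _ + _ * (X - _)](bigID (fun l : 'I_n.+1 => (l <= a)%N)) /=.
have E : (fun l : 'I_n.+1 => (l <= i)%N && (l <= a)%N) =1 (fun l : 'I_n.+1 => (l <= a)%N).
  by move=> l; apply/andP/idP => [[]|la]//; split => //; exact: leq_trans ai.
rewrite !(eq_bigl _ _ E) addrAC subrr add0r; congr (_ + _).
  apply: eq_bigr => l la; rewrite /gap_scale inE ltnNge la //.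
rewrite big_distrr /=; apply: eq_bigr => l /andP[li].
by rewrite -ltnNge /gap_scale inE => ->; rewrite (leq_trans li ib).
Qed.

Definition gap_part d (g : {mpoly K[n.+1]}) : {mpoly K[n.+1]} :=
  \sum_(m <- msupp g | deg_on gapset m == d) g@_m *: 'X_[m].

(** The value of [g] at the scaled gaps is a polynomial in [s] whose coefficient of degree [d] is
    [gap_part d g] at [y]. *)
Lemma gap_part_eq0 d g y : (forall s, g.@[gap_scale y s] = 0) ->
  (gap_part d g).@[y] = 0.
Proof.
move=> g0; pose P : {poly K} :=
  \sum_(m <- msupp g) (g@_m * \prod_i y i ^+ m i) *: 'X^(deg_on gapset m).
have P0 : P = 0.
  apply: poly_eq0_horner => s; rewrite -[RHS](g0 s) mevalE horner_sum.
  apply: eq_bigr => m _; rewrite hornerZ hornerXn -mulrA; congr (_ * _).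
  rewrite /deg_on -prodrXr mulrC big_mkcond -big_split /=.
  by apply: eq_bigr => i _; rewrite /gap_scale; case: ifP; rewrite ?mul1r ?exprMn.
move: (congr1 (fun q : {poly K} => q`_d) P0).
rewrite coef_sum_deg_on coef0 => <-; rewrite raddf_sum.
by apply: eq_bigr => m _ /=; rewrite mevalZ mevalX.
Qed.

(* The monomials of degree [d] in the gaps of the block [a, ..., b] form a
   polynomial that still vanishes whenever [k + 1] points of the block coincide;
   fixing the other gaps makes it homogeneous in the points of the block. *)
Lemma gap_exponents_ge k (g : {mpoly K[n.+1]}) m : (a <= b)%N ->
  (forall (T : {set 'I_n.+1}) y, #|T| = k.+1 ->
    {in T &, forall i j, point y i = point y j} -> g.@[y] = 0) ->
  g@_m != 0 ->
  ((b - a).+1 * ((b - a).+1 - k) <= k.*2 * deg_on gapset m)%N.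
Proof.
move=> ab gT gm; set d := deg_on gapset m.
have [y gy] : exists y, (gap_part d g).@[y] != 0.
  apply: mpoly_neq0_meval; apply/eqP => /(congr1 (mcoeff m)).
  rewrite mcoeff0 raddf_sum big_mkcond (bigD1_seq m) ?msupp_uniq ?mcoeff_msupp//=.
  rewrite eqxx mcoeffZ mcoeffX eqxx mulr1 big1 ?addr0 => [e|m' mm'].
    by rewrite e eqxx in gm.
  by case: ifP => // _; rewrite mcoeffZ mcoeffX (negbTE mm') mulr0.
(* Inside the block the gaps become differences of new variables, the points; outside they are
   frozen at the values [y], which keep [gap_part d g] nonzero. At the points of [y] itself the
   substitution returns [y]. *)
pose lq := [tuple if l \in gapset then 'X_l - 'X_(ord_prev l) else (y l)%:MP | l < n.+1] : n.+1.-tuple {mpoly K[n.+1]}.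
pose p := gap_part d g \mPo lq.
have pE x : p.@[x] = (gap_part d g).@[fun l => if l \in gapset then x l - x (ord_prev l) else y l].
  rewrite comp_mpoly_meval; apply: meval_eq => l; rewrite tnth_mktuple.
  by case: ifP => _; rewrite ?mevalC // mevalB !mevalXU.
pose B := [set l : 'I_n.+1 | (a <= l <= b)%N].
rewrite -(card_ord_itv ab) -/B; apply: (deg_vanishing (p := p)).
- apply/eqP => p0; move/negP: gy; apply; apply/eqP.
  rewrite -(meval0 (point y)) -p0 pE; apply: meval_eq => l; case: ifP => //.
  rewrite inE => /andP[al lb].
  by rewrite (point_prev y (leq_ltn_trans _ al))// addrK.
- move=> m' pm'; have ph : p \is d.-homog.
    rewrite /p /gap_part raddf_sum; apply: rpred_sum => m1 /eqP m1d /=.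
    rewrite comp_mpolyZ comp_mpolyX; apply: rpredZ.
    have -> : d = (\sum_(l < n.+1) if l \in gapset then m1 l else 0)%N.
      by rewrite -m1d /deg_on big_mkcond.
    apply: (big_rec2 (fun (q : {mpoly K[n.+1]}) e => q \is e.-homog)) => [|l q d' _ hq]; first exact: dhomog1.
    rewrite tnth_mktuple; case: ifP => _; apply: dhomogM => //.
      have := @dhomogMn _ _ _ 1 ('X_l - 'X_(ord_prev l) : {mpoly K[n.+1]}) (m1 l).
      by rewrite mul1n; apply; apply: rpredB; rewrite dhomogX /= mdeg1.
    have := @dhomogMn _ _ _ 0 ((y l)%:MP : {mpoly K[n.+1]}) (m1 l).
    rewrite mul0n; apply.
    by rewrite -[_%:MP]mulr1 mul_mpolyC; apply: rpredZ; exact: dhomog1.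
  rewrite -(dhomog_mf ph (x := m')) ?mcoeff_msupp//= mdegE /deg_on.
  by rewrite [leqRHS](bigID (mem B)) leq_addr.
- move=> T x TB Tk xT; rewrite pE; apply: gap_part_eq0 => s.
  apply: gT Tk _ => i j iT jT.
  have iB := subsetP TB _ iT; have jB := subsetP TB _ jT.
  rewrite !inE in iB jB; rewrite !point_gap_scale//; congr (_ + _ * (_ - _)).
  (* The sums of differences telescope: up to a translation, the block consists of the points
     [x l]. *)
  have E (l : 'I_n.+1) : (a <= l <= b)%N ->
    point (fun l => if l \in gapset then x l - x (ord_prev l) else y l) l = point y a + (x l - x a).
    move=> /andP[]; have [c] := ubnP (l : nat); elim: c l => // c IH l lc.
    rewrite leq_eqVlt => /predU1P[/val_inj <- _|al lb].
      rewrite subrr addr0 /point; apply: eq_bigr => i0.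
      by rewrite inE leqNgt => /negbTE ->.
    rewrite point_prev ?(leq_ltn_trans _ al)// inE al lb/=.
    have e := ord_prevE l.
    rewrite IH ?e; [ring|lia..].
  by rewrite !E// (xT i j).
Qed.

End gaps.

(** * Expansion in the gaps for a given order of the coordinates *)

Section gap_expansion.
Context {n : nat} (s : 'S_n.+1).

Definition gap (x : 'I_n.+1 -> K) (l : 'I_n.+1) :=
  if l == ord0 then x (s ord0) else x (s l) - x (s (ord_prev l)).

Lemma point_gap x i : point (gap x) i = x (s i).
Proof.
have [c] := ubnP (i : nat); elim: c i => // c IH i ic.
have [->|i0] := eqVneq i ord0.
  rewrite /point (bigD1 ord0)//= big1 ?addr0 ?/gap ?eqxx// => l /andP[l0 /eqP[]].
  by apply: val_inj => /=; lia.
have i0' : (0 < i)%N by rewrite lt0n; apply: contra i0 => /eqP i0; apply/eqP/val_inj.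
by rewrite point_prev// IH ?ord_prevE; [rewrite /gap (negbTE i0); ring|lia].
Qed.

(** Substitute for each variable the sum of the gaps up to its position in the order [s]. Points
    that coincide are then coordinates that coincide, so [gap_exponents_ge] applies to every
    monomial of the result. *)
Lemma gap_expansion k (f : {mpoly K[n.+1]}) :
  (forall (T : {set 'I_n.+1}) x, #|T| = k.+1 ->
    {in T &, forall i j, x i = x j} -> f.@[x] = 0) ->
  exists r (c : 'I_r -> K) (e : 'I_r -> 'I_n.+1 -> nat),
    (forall x, f.@[x] = \sum_j c j * \prod_l gap x l ^+ e j l) /\
    forall j (a b : 'I_n.+1), (a <= b)%N ->
    ((b - a).+1 * ((b - a).+1 - k) <=
     k.*2 * \sum_(l < n.+1 | (a < l <= b)%N) e j l)%N.
Proof.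
move=> fT; pose lq := [tuple \sum_(l < n.+1 | (l <= (s^-1)%g i)%N) 'X_l | i < n.+1] :
  n.+1.-tuple {mpoly K[n.+1]}.
have gE y : (f \mPo lq).@[y] = f.@[fun i => point y ((s^-1)%g i)].
  rewrite comp_mpoly_meval; apply: meval_eq => i; rewrite tnth_mktuple raddf_sum.
  by apply: eq_bigr => l _; rewrite /= mevalXU.
pose t := in_tuple (msupp (f \mPo lq)).
exists _, (fun j => (f \mPo lq)@_(tnth t j)), (fun j => tnth t j).
split=> [x|j a b ab].
  have -> : f.@[x] = (f \mPo lq).@[gap x].
    by rewrite gE; apply: meval_eq => i; rewrite point_gap permKV.
  by rewrite mevalE big_tnth.
have := mem_tnth j t; rewrite mcoeff_msupp; set m := tnth t j => gm.
rewrite (eq_bigl (fun l => l \in gapset a b)) => [|l]; last by rewrite inE.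
apply: (gap_exponents_ge ab _ gm) => T y Tk yT; rewrite gE.
apply: (fT (s @: T)) => [|_ _ /imsetP[i iT ->] /imsetP[i' iT' ->]].
  by rewrite card_imset//; exact: perm_inj.
by rewrite !permK; exact: yT.
Qed.

End gap_expansion.

End polynomials.

Require Import Defs.
From mathcomp Require Import all_classical all_reals all_analysis.
From mathcomp Require Import measurable_realfun complex.

Import numFieldNormedType.Exports.
Local Open Scope classical_set_scope.
Local Open Scope ring_scope.

(** * The pointwise bound *)

Section pair_sums.
Context {R : realFieldType}.

Lemma pair_sum_split (L : nat -> nat -> R) a m b : (a <= m <= b)%N ->
  \sum_(a <= j < b) \sum_(a <= i < j) L i j =
  \sum_(a <= j < m) \sum_(a <= i < j) L i j +
  \sum_(m <= j < b) \sum_(m <= i < j) L i j +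
  \sum_(m <= j < b) \sum_(a <= i < m) L i j.
Proof.
move=> /andP[am mb]; rewrite (big_cat_nat am mb) /= -addrA; congr (_ + _).
rewrite -big_split /=; apply: eq_big_nat => j /andP[mj _].
by rewrite (big_cat_nat am mj) /= addrC.
Qed.

Lemma arg_max_nat (M : nat -> R) a b : (a < b)%N ->
  exists2 m, (a <= m < b)%N & forall l, (a <= l < b)%N -> M l <= M m.
Proof.
elim: b => // b IH; rewrite ltnS leq_eqVlt => /predU1P[<-|/IH[m mab Mm]].
  by exists a; rewrite ?leqnn// => l ?; rewrite (_ : l = a)//; lia.
have [bm|mb] := leP (M b) (M m).
  exists m => [|l lab]; first lia.
  by have [->//|lb] := eqVneq l b; apply: Mm; lia.
exists b => [|l lab]; first lia.
have [->//|lb] := eqVneq l b; apply: le_trans (ltW mb); apply: Mm; lia.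
Qed.

(* In the application [L i j] is the logarithm of the distance of the points [i]
   and [j], and [L l.-1 l] that of the [l]-th gap. The induction splits the
   points at the largest gap, which all distances between the two parts exceed. *)
Lemma gap_sum_le (L : nat -> nat -> R) (beta : nat -> R) (c T : R) a b :
  0 <= c -> (a <= b)%N ->
  (forall i j l, (a <= i)%N -> (i < l)%N -> (l <= j <= b)%N -> L l.-1 l <= L i j) ->
  (forall a' b', (a <= a' <= b')%N -> (b' <= b)%N ->
    c * (b' - a')%:R * (b' - a').+1%:R <= \sum_(a'.+1 <= l < b'.+1) beta l) ->
  (forall l, (a < l <= b)%N -> L l.-1 l <= T) ->
  \sum_(a.+1 <= l < b.+1) beta l * L l.-1 l <=
    (\sum_(a.+1 <= l < b.+1) beta l - c * (b - a)%:R * (b - a).+1%:R) * T +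
    2 * c * \sum_(a <= j < b.+1) \sum_(a <= i < j) L i j.
Proof.
move=> c0; have [n] := ubnP (b - a)%N; elim: n a b T => // n IH a b T ban ab Lmon Hbeta LT.
have [ab0|ab1] := eqVneq a b.
  by rewrite -ab0 subnn big_nat1 !big_geq// !(mulr0, mul0r, subr0, addr0).
have {}ab1 : (a < b)%N by rewrite ltn_neqAle ab1.
have [m mab Mm] := @arg_max_nat (fun l => L l.-1 l) a.+1 b.+1 ab1.
case: m mab Mm => [|m] mab Mm; first by [].
set T0 := L m m.+1 in Mm.
have T0T : T0 <= T by apply: (LT m.+1).
have IHl : \sum_(a.+1 <= l < m.+1) beta l * L l.-1 l <=
    (\sum_(a.+1 <= l < m.+1) beta l - c * (m - a)%:R * (m - a).+1%:R) * T0 +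
    2 * c * \sum_(a <= j < m.+1) \sum_(a <= i < j) L i j.
  apply: IH; [lia|lia| | |].
  - by move=> i j l ai il ljm; apply: Lmon => //; lia.
  - by move=> a' b' h1 h2; apply: Hbeta; lia.
  - by move=> l lam; apply: Mm; lia.
have IHr : \sum_(m.+2 <= l < b.+1) beta l * L l.-1 l <=
    (\sum_(m.+2 <= l < b.+1) beta l - c * (b - m.+1)%:R * (b - m.+1).+1%:R) * T0 +
    2 * c * \sum_(m.+1 <= j < b.+1) \sum_(m.+1 <= i < j) L i j.
  apply: IH; [lia|lia| | |].
  - by move=> i j l ai il ljm; apply: Lmon => //; lia.
  - by move=> a' b' h1 h2; apply: Hbeta; lia.
  - by move=> l lam; apply: Mm; lia.
(* All pairs across the split are at least as far apart as the largest gap. With [u = m - a] and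
   [v = b - m - 1], the pairs add up as [(u+v+1)(u+v+2) = u(u+1) + v(v+1) + 2(u+1)(v+1)]. *)
have cross : (m.+1 - a)%:R * (b - m)%:R * T0 <=
    \sum_(m.+1 <= j < b.+1) \sum_(a <= i < m.+1) L i j.
  rewrite (_ : _ * T0 = \sum_(m.+1 <= j < b.+1) \sum_(a <= i < m.+1) T0).
    apply: ler_sum_nat => j jm; apply: ler_sum_nat => i im.
    by apply: (Lmon i j m.+1); lia.
  by rewrite !sumr_const_nat subSS -mulrnA -natrM mulr_natl.
have tot := Hbeta a b; rewrite !leqnn ltnW//= in tot; move: tot => /(_ isT isT) tot.
rewrite (@pair_sum_split L a m.+1 b.+1); last lia.
have E (F : nat -> R) : \sum_(a.+1 <= l < b.+1) F l =
    \sum_(a.+1 <= l < m.+1) F l + F m.+1 + \sum_(m.+2 <= l < b.+1) F l.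
  rewrite (@big_cat_nat _ _ _ m.+1)/=; [|lia|lia].
  by rewrite [X in _ + X = _]big_ltn ?addrA//; lia.
rewrite !E /= -/T0 in tot *.
have e1 : (b - a)%:R = (m - a)%:R + (b - m.+1)%:R + 1 :> R.
  by rewrite -natrD natr1; congr (_%:R); lia.
have e2 : (m.+1 - a)%:R = (m - a)%:R + 1 :> R by rewrite natr1; congr (_%:R); lia.
have e3 : (b - m)%:R = (b - m.+1)%:R + 1 :> R by rewrite natr1; congr (_%:R); lia.
rewrite -!natr1 e1 in tot IHl IHr *; rewrite e2 e3 in cross.
move: (\sum_(a.+1 <= l < m.+1) beta l) (\sum_(m.+2 <= l < b.+1) beta l) IHl IHr tot => Bl Br.
move: (\sum_(a.+1 <= l < m.+1) _) (\sum_(m.+2 <= l < b.+1) _) => Sl Sr.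
move: (\sum_(a <= j < m.+1) _) (\sum_(m.+1 <= j < b.+1) _)
  (\sum_(m.+1 <= j < b.+1) _) cross => Pl Px Pr cross IHl IHr tot.
move: (m - a)%:R (b - m.+1)%:R cross tot IHl IHr => u v cross tot IHl IHr.
have c2 : 0 <= 2 * c by rewrite mulr_ge0.
have h1 := ler_wpM2l c2 cross.
(* The exponent surplus of the whole block is nonnegative, so the bound obtained with [T0] only
   grows when [T0] is replaced by [T]. *)
have h2 : 0 <= (Bl + beta m.+1 + Br - c * (u + v + 1) * (u + v + 1 + 1)) * (T - T0).
  by rewrite mulr_ge0// subr_ge0.
lra.
Qed.

End pair_sums.

(** Divided by [2(k+1)], the conclusion is the block hypothesis of [gap_sum_le] for the coefficient
    [1 / (2(k+1))], when each gap receives the extra exponent [k / (2(k+1))]. It holds because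
    [2k(k+1)D >= (k+1)(l+1)(l+1-k)], while [l(l+1) - lk = l(l+1-k)]. *)
Lemma exponent_count (k l D : nat) : (0 < k)%N ->
  (l.+1 * (l.+1 - k) <= k.*2 * D)%N -> (l * l.+1 <= D.*2 * k.+1 + l * k)%N.
Proof.
move=> k0; have [lk|kl] := leqP l.+1 k.
  by move=> _; rewrite (leq_trans _ (leq_addl _ _))// leq_mul2l lk orbT.
have [u ->] : exists u, l = (k + u)%N by exists (l - k)%N; lia.
rewrite (_ : (k + u).+1 - k = u.+1)%N; last lia.
move=> H; rewrite -(leq_pmul2l k0); nia.
Qed.

Section monomial_bound.
Context {R : realType}.

(** This is the exponential of [gap_sum_le] for the logarithms of the distances. The extra exponent
    [alpha] that the block condition requires reappears as negative powers of the gaps. *)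
Lemma monomial_le n k (m : nat -> nat) (c M : R) : (0 < k)%N ->
  0 <= c <= k.+1%:R^-1 ->
  (forall a b, (a <= b <= n)%N ->
    ((b - a).+1 * ((b - a).+1 - k) <= k.*2 * \sum_(a.+1 <= l < b.+1) m l)%N) ->
  exists2 C : R, 0 <= C & forall p : nat -> R,
  (forall i j, (i < j <= n)%N -> p i < p j) ->
  (forall l, (0 < l <= n)%N -> p l - p l.-1 <= M) ->
  \prod_(1 <= l < n.+1) (p l - p l.-1) ^+ m l <=
  C * (\prod_(0 <= j < n.+1) \prod_(0 <= i < j) (p j - p i) `^ c) *
   \prod_(1 <= l < n.+1) (p l - p l.-1) `^ (- (k%:R / k.+1%:R / 2)).
Proof.
move=> k0 /andP[c0 ck] mD; set alpha := k%:R / k.+1%:R / 2.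
pose beta l := (m l)%:R + alpha.
(* The number [E] is the total exponent of the gaps, [alpha] included, minus the degree of the
   product of distances; the constant is thus [M] to the power [E]. *)
pose E := \sum_(1 <= l < n.+1) beta l - c / 2 * (n - 0)%:R * (n - 0).+1%:R.
exists (expR (E * ln M)) => [|p pmon pM]; first exact: expR_ge0.
pose L i j := ln (p j - p i).
have d0 i j : (i < j <= n)%N -> 0 < p j - p i by move=> /pmon; rewrite subr_gt0.
have main := @gap_sum_le R L beta (c / 2) (ln M) 0 n.
have {main} : \sum_(1 <= l < n.+1) beta l * L l.-1 l <=
    E * ln M + 2 * (c / 2) * \sum_(0 <= j < n.+1) \sum_(0 <= i < j) L i j.
  apply: main => //.
  - by rewrite divr_ge0.
  - move=> i j l _ il ljn; rewrite /L ler_ln ?posrE; [|apply: d0; lia|apply: d0; lia].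
    apply: lerB.
      by have [->//|lj] := eqVneq l j; apply/ltW/pmon; lia.
    by have [->//|lj] := eqVneq i l.-1; apply/ltW/pmon; lia.
  - move=> a b /andP[_ ab] bn; rewrite big_split /= sumr_const_nat subSS -natr_sum.
    set D := (\sum_(_ <= _ < _) _)%N; have := mD a b; rewrite ab bn -/D => /(_ isT).
    move=> /(exponent_count k0); rewrite -(ler_nat R) -/D.
    move: (b - a)%N => l; rewrite natrD !natrM -!muln2 natrM => H.
    have k1 : 0 < k.+1%:R :> R by rewrite ltr0n.
    rewrite -(ler_pM2l k1) -[alpha *+ l]mulr_natr.
    have e : k.+1%:R * (k%:R / k.+1%:R) = k%:R :> R by rewrite mulrCA mulfV ?mulr1// gt_eqF.
    have c1 : k.+1%:R * c <= 1 by rewrite mulrC -ler_pdivlMr// div1r.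
    have l0 : 0 <= l%:R * l.+1%:R :> R by rewrite mulr_ge0.
    have h := ler_wpM2r l0 c1.
    rewrite /alpha mulrDr; move: e h H.
    set q := k%:R / k.+1%:R; set kk := k.+1%:R; set ll := l.+1%:R => e h H.
    have -> : kk * (q / 2 * l%:R) = kk * q * l%:R / 2 by ring.
    rewrite e; lra.
  - move=> l lh; rewrite /L ler_ln ?posrE; [apply: pM; lia|apply: d0; lia|].
    by apply: lt_le_trans (pM l _); [apply: d0; lia|lia].
move=> H0; have H := etrans (ler_expR _ _) H0; move: H => {H0}.
rewrite expRD !expR_sum (_ : 2 * (c / 2) = c); last by field.
rewrite mulr_sumr expR_sum => H.
have g0 l : (0 < l < n.+1)%N -> 0 < p l - p l.-1 by move=> ?; apply: d0; lia.
have H1 : \prod_(1 <= l < n.+1) expR (beta l * L l.-1 l) =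
    \prod_(1 <= l < n.+1) (p l - p l.-1) ^+ m l * \prod_(1 <= l < n.+1) (p l - p l.-1) `^ alpha.
  rewrite -big_split /=; apply: eq_big_nat => l ln; have lp := g0 l ln.
  rewrite /beta mulrDl expRD; congr (_ * _); last by rewrite /powR gt_eqF.
  by rewrite expRM_natl lnK ?posrE.
have H2 : \prod_(0 <= j < n.+1) expR (c * \sum_(0 <= i < j) L i j) =
    \prod_(0 <= j < n.+1) \prod_(0 <= i < j) (p j - p i) `^ c.
  apply: eq_big_nat => j jn; rewrite mulr_sumr expR_sum.
  apply: eq_big_nat => i ij; rewrite /powR gt_eqF//.
  by apply: d0; lia.
rewrite H1 H2 in H.
have H3 : \prod_(1 <= l < n.+1) (p l - p l.-1) `^ alpha *
    \prod_(1 <= l < n.+1) (p l - p l.-1) `^ (- alpha) = 1.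
  rewrite -big_split /= big_nat_cond big1// => l /andP[ln _].
  rewrite -powRD ?subrr ?powRr0//.
  by apply/implyP => _; rewrite gt_eqF ?g0.
rewrite -[leLHS]mulr1 -[X in _ * X <= _]H3 mulrA ler_wpM2r//.
by apply: prodr_ge0 => l _; exact: powR_ge0.
Qed.

End monomial_bound.

(** * Products of Riesz kernels along a path *)

Section chains.
Context {R : realType} (a : R).

Definition rieszk (x y : R) := `|x - y| `^ (- a).

Fixpoint chain_from x (s : seq R) :=
  if s is y :: s' then rieszk x y * chain_from y s' else 1.

Definition chain s := if s is x :: s' then chain_from x s' else 1.

(** Each entry is paired only with later ones, so the head occurs in a single factor and can be
    integrated out first. *)
Fixpoint majorant (s : seq R) :=
  if s is x :: s' then (1 + \sum_(y <- s') rieszk x y) * majorant s' else 1.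

Lemma rieszk_ge0 x y : 0 <= rieszk x y. Proof. exact: powR_ge0. Qed.

Lemma rieszkC x y : rieszk x y = rieszk y x. Proof. by rewrite /rieszk distrC. Qed.

Lemma chain_ge0 s : 0 <= chain s.
Proof.
case: s => //= x s; elim: s x => //= y s IH x.
by rewrite mulr_ge0 ?rieszk_ge0.
Qed.

Lemma majorant_ge0 s : 0 <= majorant s.
Proof.
elim: s => //= x s IH; rewrite mulr_ge0// addr_ge0//.
by apply: sumr_ge0 => y _; exact: rieszk_ge0.
Qed.

Lemma chain_cat x s y s' :
  chain (rcons s x ++ y :: s') = chain (rcons s x) * rieszk x y * chain (y :: s').
Proof.
case: s => [|z s] /=; first by rewrite mul1r.
by elim: s z => [|w s IH] z /=; [rewrite mulr1 mulrA|rewrite IH !mulrA].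
Qed.

Lemma chain_iota (p : nat -> R) b n :
  chain [seq p i | i <- iota b n.+1] =
  \prod_(b.+1 <= l < (b + n).+1) rieszk (p l.-1) (p l).
Proof.
elim: n b => [|n IH] b; first by rewrite addn0 big_geq.
rewrite big_ltn; last lia.
by move: (IH b.+1) => /=; rewrite addSnnS => <-.
Qed.

Context (a01 : 0 <= a <= 1).

(** If [z] is the closer of the two to [x], then [|y - z| <= 2 |x - y|], so the kernel at [x], [y]
    is at most [2 ^ a <= 2] times the kernel at [y], [z]. *)
Lemma rieszk_triangle x y z : x != y -> x != z -> y != z ->
  rieszk y x * rieszk x z <= 2 * rieszk y z * (rieszk x y + rieszk x z).
Proof.
move: a01 => /andP[a0 a1] xy xz yz; rewrite [rieszk y x]rieszkC.
wlog le : y z xy xz yz / `|x - z| <= `|x - y| => [wl|].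
  have [|/ltW le] := leP `|x - z| `|x - y|; first exact: wl.
  rewrite [rieszk x y * _]mulrC [rieszk x y + _]addrC [rieszk y z]rieszkC.
  by apply: wl; rewrite // eq_sym.
suff h : rieszk x y <= 2 * rieszk y z.
  rewrite mulrDr ler_wpDl// ?mulr_ge0 ?rieszk_ge0//.
  by rewrite ler_wpM2r ?rieszk_ge0.
have p (w t : R) : w != t -> 0 < `|w - t| by rewrite normr_gt0 subr_eq0.
have tri : `|y - z| <= 2 * `|x - y|.
  have -> : y - z = (x - z) - (x - y) by ring.
  by apply: le_trans (ler_normB _ _) _; lra.
have : 2 `^ (- a) * `|x - y| `^ (- a) <= `|y - z| `^ (- a).
  rewrite -powRM// !powRN lef_pV2 ?posrE ?powR_gt0 ?p// ?mulr_gt0 ?p//.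
  by rewrite ge0_ler_powR ?nnegrE.
rewrite -/(rieszk x y) -/(rieszk y z) powRN => h.
have : rieszk x y <= 2 `^ a * rieszk y z by rewrite -ler_pdivrMl ?powR_gt0.
move=> /le_trans; apply; rewrite ler_wpM2r ?rieszk_ge0//.
by rewrite -[leRHS](@powRr1 _ 2)// ler_powR// ler1n.
Qed.

(** Inserting [x] between neighbours [u] and [v] replaces one kernel by two, which [rieszk_triangle]
    compares; at an end of the path it only adds one kernel. The resulting factor does not depend on
    the position of [x]. *)
Lemma chain_insert x s s' : uniq (x :: s ++ s') ->
  chain (s ++ x :: s') <= 2 * (1 + \sum_(y <- s ++ s') rieszk x y) * chain (s ++ s').
Proof.
have S0 (r : seq R) : 0 <= \sum_(y <- r) rieszk x y.
  by apply: sumr_ge0 => y _; exact: rieszk_ge0.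
case: (lastP s) => [|{}s u]; case: s' => [|v s'].
- by rewrite big_nil /=; lra.
- move=> _; rewrite big_cons /= ler_wpM2r ?(chain_ge0 (v :: s'))//.
  by have := rieszk_ge0 x v; have := S0 s'; lra.
- move=> _; rewrite chain_cat cats0 /= mulr1 [rieszk u x]rieszkC mulrC.
  rewrite ler_wpM2r ?chain_ge0// -cats1 big_cat /= big_seq1.
  by have := rieszk_ge0 x u; have := S0 s; lra.
move=> /= /andP[xn un].
have xu : x != u by apply: contraNneq xn => ->; rewrite mem_cat mem_rcons inE eqxx.
have xv : x != v by apply: contraNneq xn => ->; rewrite mem_cat inE eqxx orbT.
have uv : u != v.
  move: un; rewrite -cats1 -catA cat_uniq => /and3P[_ _ /andP[+ _]].
  by rewrite inE negb_or => /andP[].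
have E : chain (rcons s u ++ x :: v :: s') =
    chain (rcons s u) * (rieszk u x * rieszk x v) * chain (v :: s').
  by rewrite chain_cat /= !mulrA.
rewrite E chain_cat big_cat -cats1 big_cat big_seq1 big_cons /= cats1.
have h : rieszk u x * rieszk x v <=
    2 * (1 + (\sum_(y <- s) rieszk x y + rieszk x u + (rieszk x v + \sum_(y <- s') rieszk x y))) * rieszk u v.
  apply: le_trans (rieszk_triangle xu xv uv) _.
  rewrite mulrAC ler_wpM2r ?rieszk_ge0// ler_wpM2l//.
  by have := S0 s; have := S0 s'; lra.
move: h; set k2 := rieszk u v; set S := 1 + _ => h.
have -> : 2 * S * (chain (rcons s u) * k2 * chain (v :: s')) =
    chain (rcons s u) * (2 * S * k2) * chain (v :: s') by ring.
by apply: ler_wpM2r; [exact: (chain_ge0 (v :: s'))|rewrite ler_wpM2l ?chain_ge0].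
Qed.

(** Build [s'] by inserting the entries of [s] one at a time, from the last to the first; each
    insertion costs a factor 2 and the corresponding factor of the majorant. *)
Lemma chain_le_majorant s s' : uniq s -> perm_eq s s' ->
  chain s' <= 2 ^+ size s * majorant s.
Proof.
elim: s s' => [|x s IH] s' us.
  by rewrite perm_sym => /perm_nilP -> /=; rewrite mulr1.
move=> ss'; have xs' : x \in s' by rewrite -(perm_mem ss') inE eqxx.
move: ss'; case/splitPr: xs' => s1 s2 ss'.
have ps : perm_eq s (s1 ++ s2).
  by rewrite -(perm_cons x) (perm_trans ss')// perm_catC /= perm_cons perm_catC.
have {}us := us; have us2 : uniq (x :: s1 ++ s2).
  by rewrite -(perm_uniq (s1 := x :: s)) ?perm_cons.
apply: le_trans (chain_insert us2) _.
rewrite -(perm_big _ ps) /= exprS mulrACA ler_wpM2l//.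
  by rewrite mulr_ge0// addr_ge0// sumr_ge0// => y _; exact: rieszk_ge0.
by apply: IH => //; case/andP: us.
Qed.

End chains.

Section ideal.

(** Passes from increasing index sequences to index sets: [enum_val] lists [T] in increasing
    order. *)
Lemma equal_coord_ideal_vanish (C : fieldType) (N k : nat) (f : {mpoly C[N]}) :
  f \in equal_coord_ideal C N k ->
  forall (T : {set 'I_N}) x, #|T| = k.+1 ->
    {in T &, forall i j, x i = x j} -> f.@[x] = 0.
Proof.
rewrite inE => fI T x Tk xT.
pose s (i : 'I_k.+1) : 'I_N := enum_val (cast_ord (esym Tk) i).
apply: (fI s) => [i j ij|i j]; last by apply: xT; exact: enum_valP.
have srt : sorted ltn [seq val i | i <- enum T].
  rewrite /enum_mem -enumT; apply: (@subseq_sorted _ _ ltn_trans _ _ _ (iota_ltn_sorted 0 N)).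
  by rewrite -val_enum_ord; apply: map_subseq; exact: filter_subseq.
have i0 : 'I_N := s ord0.
rewrite /s !(enum_val_nth i0) -!(nth_map _ 0%N val) -?cardE ?ltn_ord//.
by rewrite (sorted_ltn_nth ltn_trans 0%N srt)// inE size_map -cardE ltn_ord.
Qed.

End ideal.

(** * The denominator, and the bound for one order of the coordinates *)

Section vandermonde.
Context {R : realType}.

Definition vdm n (c : R) (x : 'I_n -> R) :=
  \prod_(i < n) \prod_(j < n | (i < j)%N) `|x i - x j| `^ c.

Lemma vdm_ge0 n c (x : 'I_n -> R) : 0 <= vdm c x.
Proof.
by apply: prodr_ge0 => i _; apply: prodr_ge0 => j _; exact: powR_ge0.
Qed.

Lemma vdm_gt0 n c (x : 'I_n -> R) : injective x -> 0 < vdm c x.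
Proof.
move=> xI; apply: prodr_gt0 => i _; apply: prodr_gt0 => j ij; apply: powR_gt0.
by rewrite normr_gt0 subr_eq0 (inj_eq xI) -(inj_eq val_inj) neq_ltn ij.
Qed.

Lemma vdm_swap n c (x : 'I_n -> R) :
  vdm c x = \prod_(i < n) \prod_(j < n | (j < i)%N) `|x i - x j| `^ c.
Proof.
rewrite /vdm (exchange_big_dep xpredT)//=; apply: eq_bigr => i _.
by apply: eq_bigr => j _; rewrite distrC.
Qed.

(** The square is a product over all ordered pairs of distinct indices, which a permutation only
    reorders. *)
Lemma vdm_perm n c (x : 'I_n -> R) (s : 'S_n) : vdm c (x \o s) = vdm c x.
Proof.
have sq y : vdm c y * vdm c y = \prod_(i < n) \prod_(j < n | j != i) `|y i - y j| `^ c.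
  rewrite {2}vdm_swap -big_split /=; apply: eq_bigr => i _.
  rewrite [RHS](bigID (fun j : 'I_n => (i < j)%N)) /=; congr (_ * _); apply: eq_bigl => j;
    rewrite -(inj_eq val_inj) /=; lia.
have : vdm c (x \o s) ^+ 2 = vdm c x ^+ 2.
  rewrite !expr2 !sq [RHS](reindex_inj (@perm_inj _ s)) /=; apply: eq_bigr => i _.
  rewrite [RHS](reindex_inj (@perm_inj _ s)) /=; apply: eq_bigl => j.
  by rewrite (inj_eq perm_inj).
by move/eqP; rewrite eqrXn2 ?vdm_ge0// => /eqP.
Qed.

Lemma vdm_sorted n c (x : 'I_n.+1 -> R) (s : 'S_n.+1) (p := fun l => x (s (inord l))) :
  (forall i j : 'I_n.+1, (i < j)%N -> x (s i) < x (s j)) ->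
  vdm c x = \prod_(0 <= j < n.+1) \prod_(0 <= i < j) (p j - p i) `^ c.
Proof.
move=> xs; rewrite -(vdm_perm c x s) vdm_swap big_mkord; apply: eq_bigr => j _.
rewrite (big_nat_widen 0 j n.+1 _ _ (ltnW (ltn_ord j))) big_mkord.
apply: eq_bigr => i ij; rewrite /p !inord_val /= gtr0_norm// subr_gt0.
exact: xs.
Qed.

Lemma normc_sum (I : Type) (r : seq I) (F : I -> R[i]) :
  Normc.normc (\sum_(i <- r) F i) <= \sum_(i <- r) Normc.normc (F i).
Proof.
elim/big_ind2: _ => [|x y x' y' hx hy|//]; first by rewrite Normc.normc0.
by apply: le_trans (le_normcD _ _) _; exact: lerD.
Qed.

Lemma normc_real (x : R) : Normc.normc x%:C%C = `|x|.
Proof. by rewrite /= expr0n addr0 sqrtr_sqr. Qed.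

Lemma normc_ge0 (z : R[i]) : 0 <= Normc.normc z.
Proof. by case: z => u v; exact: sqrtr_ge0. Qed.

Lemma normc_prod (I : Type) (r : seq I) (F : I -> R[i]) :
  Normc.normc (\prod_(i <- r) F i) = \prod_(i <- r) Normc.normc (F i).
Proof. by rewrite (big_morph _ (@Normc.normcM R) (Normc.normc1 R)). Qed.

Lemma normcX (z : R[i]) m : Normc.normc (z ^+ m) = Normc.normc z ^+ m.
Proof.
elim: m => [|m IH]; first by rewrite !expr0 Normc.normc1.
by rewrite !exprS Normc.normcM IH.
Qed.

(** Each term of [gap_expansion] is bounded by [monomial_le]; the ideal enters only through the
    resulting exponent bounds. *)
Lemma sorted_bound n k (c M : R) (f : {mpoly R[i][n.+1]}) (s : 'S_n.+1) : (0 < k)%N ->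
  0 <= c <= k.+1%:R^-1 -> f \in equal_coord_ideal R[i] n.+1 k ->
  exists2 C : R, 0 <= C & forall x : 'I_n.+1 -> R,
    let p l := x (s (inord l)) in
    (forall i j : 'I_n.+1, (i < j)%N -> x (s i) < x (s j)) -> (forall i, `|x i| <= M) ->
    Normc.normc f.@[fun i => (x i)%:C%C] <=
    C * (vdm c x * \prod_(1 <= l < n.+1) (p l - p l.-1) `^ (- (k%:R / k.+1%:R / 2))).
Proof.
move=> k0 ck /equal_coord_ideal_vanish fI.
have [r [u [e' [fE eD]]]] := gap_expansion s fI.
pose e j l := e' j (inord l).
have mon j : exists C : R, 0 <= C /\ (forall p : nat -> R,
    (forall i j, (i < j <= n)%N -> p i < p j) ->
    (forall l, (0 < l <= n)%N -> p l - p l.-1 <= M + M) ->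
    \prod_(1 <= l < n.+1) (p l - p l.-1) ^+ e j l <=
    C * (\prod_(0 <= j < n.+1) \prod_(0 <= i < j) (p j - p i) `^ c) *
    \prod_(1 <= l < n.+1) (p l - p l.-1) `^ (- (k%:R / k.+1%:R / 2))).
  have [|C C0 H] := @monomial_le R n k (e j) c (M + M) k0 ck; last by exists C.
  move=> a b /andP[ab bn]; have an : (a <= n)%N by lia.
  have := eD j (inord a) (inord b).
  rewrite !inordK// => /(_ ab); congr (_ <= _ * _)%N.
  rewrite (big_nat_widenl a.+1 0)// (big_nat_widen 0 b.+1 n.+1)// big_mkord.
  by apply: eq_big => l; rewrite /e ?inord_val// ltnS andbC.
have {mon}[C CP] := choice mon.
(* The entry of [gap] at [ord0] is a point and not a distance, so its power is bounded separately by
   a power of [|M|]. *)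
exists (\sum_j Normc.normc (u j) * (`|M| ^+ e j 0%N * C j)).
  apply: sumr_ge0 => j _; rewrite mulr_ge0 ?normc_ge0// mulr_ge0 ?exprn_ge0//.
  by case: (CP j).
move=> x p xs xM; rewrite fE; apply: le_trans (normc_sum _ _) _.
rewrite mulr_suml; apply: ler_sum => j _.
have [C0 CM] := CP j.
have {}CM : \prod_(1 <= l < n.+1) (p l - p l.-1) ^+ e j l <=
    C j * (\prod_(0 <= j < n.+1) \prod_(0 <= i < j) (p j - p i) `^ c) *
    \prod_(1 <= l < n.+1) (p l - p l.-1) `^ (- (k%:R / k.+1%:R / 2)).
  apply: CM => [i i' /andP[ij jn]|l /andP[l0 ln]].
    by apply: xs; rewrite !inordK//; lia.
  have := xM (s (inord l)); have := xM (s (inord l.-1)).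
  by rewrite /p !ler_norml => /andP[+ _] /andP[_]; lra.
rewrite Normc.normcM -[leRHS]mulrA ler_wpM2l ?normc_ge0//.
rewrite normc_prod big_ord_recl /= normcX /gap eqxx normc_real -[leRHS]mulrA.
apply: ler_pM.
- exact: exprn_ge0.
- by apply: prodr_ge0 => l _; exact: normc_ge0.
- rewrite /e (_ : inord 0 = ord0); last by apply/val_inj; rewrite /= inordK.
  by apply: lerXn2r; rewrite ?nnegrE// (le_trans (xM _)) ?ler_norm.
rewrite (vdm_sorted c xs) [leRHS]mulrA; apply: le_trans CM.
rewrite big_add1 big_mkord le_eqVlt; apply/orP; left; apply/eqP.
apply: eq_bigr => l _; rewrite normcX -rmorphB normc_real.
have lE : inord l.+1 = lift ord0 l :> 'I_n.+1.
  by apply/val_inj; rewrite /= inordK// ltnS ltn_ord.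
rewrite /e /p lE /ord_prev /= add0n gtr0_norm// subr_gt0.
by apply: xs; rewrite inordK /bump ?leq0n ?add1n// ltnW// ltnS ltn_ord.
Qed.

End vandermonde.

(** * The bound on a box for all orders of the coordinates *)

Section pointwise_bound.
Context {R : realType}.

Lemma normc_vandermonde_quotient N (c : R) (f : {mpoly R[i][N]}) (t : N.-tuple R) :
  Normc.normc (vandermonde_quotient c f t) =
  Normc.normc f.@[fun i => (tnth t i)%:C%C] * (vdm c (tnth t))^-1.
Proof.
by rewrite Normc.normcM Normc.normcV normc_real ger0_norm// vdm_ge0.
Qed.

Lemma majorant_ge1 a (s : seq R) : 1 <= majorant a s.
Proof.
elim: s => //= x s IH; rewrite -[leLHS]mul1r ler_pM// lerDl.
by apply: sumr_ge0 => y _; exact: rieszk_ge0.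
Qed.

Lemma meval_box_bound N (M : R) (f : {mpoly R[i][N]}) :
  exists2 B, 0 <= B & forall x : 'I_N -> R, (forall i, `|x i| <= M) ->
    Normc.normc f.@[fun i => (x i)%:C%C] <= B.
Proof.
exists (\sum_(m <- mpoly.msupp f) Normc.normc (mpoly.mcoeff m f) *
    \prod_i `|M| ^+ mpoly.fun_of_multinom m i).
  apply: sumr_ge0 => m _; rewrite mulr_ge0 ?normc_ge0//.
  by apply: prodr_ge0 => i _; rewrite exprn_ge0.
move=> x xM; rewrite mpoly.mevalE; apply: le_trans (normc_sum _ _) _.
apply: ler_sum => m _; rewrite Normc.normcM ler_wpM2l ?normc_ge0//.
rewrite normc_prod; apply: ler_prod => i _; rewrite normcX normc_real exprn_ge0//=.
by apply: lerXn2r; rewrite ?nnegrE// (le_trans (xM _)) ?ler_norm.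
Qed.

(** For [c <= 0] dividing by the denominator means multiplying by nonnegative powers of distances;
    the quotient is bounded on the box, and the majorant is at least 1. *)
Lemma pointwise_bound_le0 N (c M : R) (f : {mpoly R[i][N]}) a : c <= 0 ->
  exists2 C, 0 <= C & forall t : N.-tuple R, (forall i, `|tnth t i| <= M) ->
    Normc.normc (vandermonde_quotient c f t) ^+ 2 <= C * majorant a t.
Proof.
move=> c0; have [B B0 fB] := meval_box_bound M f.
pose V := \prod_(i < N) \prod_(j < N | (i < j)%N) (`|M| + `|M|) `^ (- c).
have V0 : 0 <= V by apply: prodr_ge0 => i _; apply: prodr_ge0 => j _; exact: powR_ge0.
exists ((B * V) ^+ 2) => [|t tM]; first exact: sqr_ge0.
apply: (@le_trans _ _ ((B * V) ^+ 2)); last by rewrite ler_peMr ?sqr_ge0// majorant_ge1.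
rewrite lerXn2r ?nnegrE ?normc_ge0 ?mulr_ge0// normc_vandermonde_quotient.
apply: ler_pM; rewrite ?normc_ge0 ?invr_ge0 ?vdm_ge0//; first exact: fB.
rewrite /vdm -prodfV; apply: ler_prod => i _; rewrite invr_ge0 prodr_ge0/= => [|j _];
  last exact: powR_ge0.
rewrite -prodfV; apply: ler_prod => j _; rewrite -powRN powR_ge0/=.
rewrite ge0_ler_powR ?nnegrE ?oppr_ge0// ?addr_ge0//.
apply: le_trans (ler_normB _ _) _; apply: lerD; apply: le_trans (tM _) (ler_norm _).
Qed.

Lemma pointwise_bound n k (c M : R) (f : {mpoly R[i][n.+1]}) : (0 < k)%N ->
  c <= k.+1%:R^-1 -> f \in equal_coord_ideal R[i] n.+1 k ->
  exists2 C, 0 <= C & forall t : n.+1.-tuple R, (forall i, `|tnth t i| <= M) ->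
    Normc.normc (vandermonde_quotient c f t) ^+ 2 <= C * majorant (k%:R / k.+1%:R) t.
Proof.
move=> k0 ck fI; set a := k%:R / k.+1%:R.
have [c0|c0] := leP c 0; first exact: pointwise_bound_le0.
have a01 : 0 <= a <= 1.
  by rewrite divr_ge0//= ler_pdivrMr// mul1r ler_nat.
have ck' : 0 <= c <= k.+1%:R^-1 by rewrite ltW.
(* There is one constant for each order [s] of the coordinates; summing over [s] makes the final
   constant independent of the point. The power of 2 comes from [chain_le_majorant]. *)
have main s := @sorted_bound R n k c M f s k0 ck' fI.
have {main}[C CP] := choice (fun s => let: ex_intro2 C C0 H := main s in ex_intro _ C (conj C0 H)).
exists (\sum_s C s ^+ 2 * 2 ^+ n.+1) => [|t tM].
  by apply: sumr_ge0 => s _; rewrite mulr_ge0 ?sqr_ge0// exprn_ge0.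
(* If two coordinates coincide, the denominator is 0, as [c > 0], and the quotient is 0 by the
   convention for the inverse of 0. *)
have [tU|tU] := boolP (uniq t); last first.
  rewrite normc_vandermonde_quotient (_ : vdm c (tnth t) = 0).
    rewrite invr0 mulr0 expr0n mulr_ge0 ?majorant_ge0//.
    by apply: sumr_ge0 => s _; rewrite mulr_ge0 ?sqr_ge0// exprn_ge0.
  have [i [j [ij jn tij]]] := uniqPn 0 tU; rewrite size_tuple in jn.
  have ni : (i < n.+1)%N by exact: ltn_trans jn.
  rewrite /vdm (bigD1 (Ordinal ni))//= (bigD1 (Ordinal jn))//=.
  rewrite !(tnth_nth 0)/= tij subrr normr0 powR0 ?gt_eqF//.
  by rewrite !mul0r.
have : perm_eq (sort <=%R t) t by rewrite perm_sort.
case/tuple_permP => s st.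
have tI : injective (tnth t) by apply/tuple_uniqP.
have srt : forall i j : 'I_n.+1, (i < j)%N -> tnth t (s i) < tnth t (s j).
  have slt : sorted <%R (sort <=%R t).
    by rewrite lt_sorted_uniq_le sort_uniq tU sort_le_sorted.
  have E (i : 'I_n.+1) : tnth t (s i) = nth 0 (sort <=%R t) i.
    by rewrite st -tnth_nth tnth_mktuple.
  move=> i j ij; rewrite !E (sorted_ltn_nth lt_trans 0 slt)// inE size_sort size_tuple;
    exact: ltn_ord.
have [C0 /(_ _ srt tM)] := CP s.
set p := fun l => tnth t (s (inord l)); cbn zeta; rewrite -/p => H.
have {H} : Normc.normc (vandermonde_quotient c f t) <=
    C s * \prod_(1 <= l < n.+1) (p l - p l.-1) `^ (- (a / 2)).
  rewrite normc_vandermonde_quotient ler_pdivrMr ?vdm_gt0//.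
  by rewrite -[leRHS]mulrA [X in _ * X]mulrC.
(* Squaring turns the exponent [- (a / 2)] into [- a], which gives the chain along the sorted
   points. *)
move=> H; have {H} : Normc.normc (vandermonde_quotient c f t) ^+ 2 <=
    C s ^+ 2 * chain a (sort <=%R t).
  have -> : sort <=%R t = [seq p l | l <- iota 0 n.+1].
    rewrite st -val_enum_ord -map_comp /=; apply: eq_map => l.
    by rewrite /p /= inord_val.
  rewrite chain_iota.
  have -> : \prod_(1 <= l < n.+1) rieszk a (p l.-1) (p l) =
      (\prod_(1 <= l < n.+1) (p l - p l.-1) `^ (- (a / 2))) ^+ 2.
    rewrite -prodrXl; apply: eq_big_nat => l /andP[l0 ln].
    have pl : 0 < p l - p l.-1 by rewrite subr_gt0; apply: srt; rewrite !inordK//; lia.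
    rewrite /rieszk distrC gtr0_norm// expr2 -powRD; last by rewrite (gt_eqF pl) implybT.
    by congr (_ `^ _); field.
  rewrite -exprMn lerXn2r ?nnegrE ?normc_ge0//.
  by rewrite mulr_ge0// prodr_ge0// => l _; exact: powR_ge0.
move=> /le_trans; apply.
rewrite mulr_suml (bigD1 s)//= ler_wpDr//.
  apply: sumr_ge0 => i _; rewrite mulr_ge0 ?majorant_ge0// mulr_ge0 ?sqr_ge0// exprn_ge0.
rewrite -[leRHS]mulrA ler_wpM2l ?sqr_ge0//.
have /(chain_le_majorant a01 tU) : perm_eq t (sort <=%R t) by rewrite perm_sym perm_sort.
by rewrite size_tuple.
Qed.

End pointwise_bound.

(** * Integration of the majorant *)

Section kernel_integral.
Context {R : realType}.
Local Notation mu := (@lebesgue_measure R).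

(* Dyadic decomposition: [u^-a <= 2^(a (j+1))] when [2^-(j+1) < u <= 2^-j]. *)
Definition dyadic_kernel (a y : R) j (x : R) : \bar R :=
  (((2 `^ a) ^+ j.+1)%:E * (\1_(`[y - 2^-1 ^+ j, y + 2^-1 ^+ j]) x)%:E)%E.

Lemma dyadic_kernel_ge0 a y j x : (0 <= dyadic_kernel a y j x)%E.
Proof. by rewrite mule_ge0// lee_fin ?exprn_ge0 ?powR_ge0. Qed.

(** The summand 1 covers [|x - y| >= 1] and also [x = y], where the convention for powers of 0 gives
    at most 1. Otherwise the term for the least [j] with [2^-(j+1) < |x - y|] suffices. *)
Lemma rieszk_le_dyadic (a x y : R) : 0 <= a ->
  ((rieszk a x y)%:E <= 1 + \sum_(0 <= j <oo) dyadic_kernel a y j x)%E.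
Proof.
move=> a0; have S0 : (0 <= \sum_(0 <= j <oo) dyadic_kernel a y j x)%E.
  by apply: nneseries_ge0 => j _ _; exact: dyadic_kernel_ge0.
have [u1|u1] := leP 1 `|x - y|.
  rewrite -[leLHS]adde0; apply: leeD => //; rewrite lee_fin /rieszk powRN.
  rewrite invf_le1 ?powR_gt0 ?(lt_le_trans _ u1)//.
  by rewrite -(congr1 (@^~ a) (powR1 R)) ge0_ler_powR ?nnegrE.
have [xy|xy] := eqVneq x y.
  rewrite -[leLHS]adde0; apply: leeD => //; rewrite lee_fin /rieszk xy subrr normr0.
  by rewrite /powR eqxx; case: eqP.
have u0 : 0 < `|x - y| by rewrite normr_gt0 subr_eq0.
have ex : exists j, 2^-1 ^+ j.+1 < `|x - y|.
  have : (2^-1 : R) ^+ n @[n --> \oo] --> (0 : R).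
    by apply: cvg_expr; rewrite ger0_norm// invf_lt1// ltr1n.
  move=> /cvgrPdist_lt /(_ _ u0)[n _ /(_ n.+1 (leqnSn n))].
  by rewrite sub0r normrN ger0_norm ?exprn_ge0//; exists n.
have [j ju minj] := ex_minnP ex.
have uj : `|x - y| <= 2^-1 ^+ j.
  case: j ju minj => [_ _|j _ minj]; first by rewrite expr0 ltW.
  by rewrite leNgt; apply/negP => /minj; rewrite ltnn.
rewrite -[leLHS]add0e; apply: leeD => //.
apply: le_trans (nneseries_lim_ge j.+1 _); last by move=> i _ _; exact: dyadic_kernel_ge0.
rewrite big_nat_recr//=; apply: le_trans (leeDr _ _); last first.
  by apply: sume_ge0 => i _; exact: dyadic_kernel_ge0.
rewrite /dyadic_kernel indicE mem_set ?mule1 ?lee_fin; last first.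
  by rewrite /= in_itv/= -ler_distlC distrC.
have pX z n : 0 <= z -> (z ^+ n) `^ a = (z `^ a) ^+ n.
  move=> z0; elim: n => [|n IH]; first by rewrite !expr0 (congr1 (@^~ a) (powR1 R)).
  by rewrite !exprS powRM ?exprn_ge0// IH.
have e : (2 `^ a) ^+ j.+1 = ((2^-1 ^+ j.+1) `^ a)^-1.
  rewrite pX// -exprVn; congr (_ ^+ _); apply/esym/mulr1_eq.
  by rewrite -powRM// mulVf// (congr1 (@^~ a) (powR1 R)).
rewrite /rieszk powRN e lef_pV2 ?posrE ?powR_gt0 ?exprn_gt0//.
by rewrite ge0_ler_powR ?nnegrE ?exprn_ge0// ltW.
Qed.

Lemma measurable_rieszk (a y : R) : measurable_fun [set: R] (rieszk a ^~ y).
Proof.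
apply: (measurableT_comp (measurable_powR _)).
apply: measurableT_comp; first exact: normr_measurable.
by apply: measurable_funB.
Qed.

(** With [b = 2 ^ a], the dyadic term [j] has integral at most [b^(j+1)] times [2 / 2^j], that is
    [2 b q^j] with [q = b / 2]. The series converges since [a < 1] means [q < 1], and nothing
    depends on [y]. *)
Lemma integral_rieszk_bounded (a M : R) : 0 <= a < 1 -> 0 <= M ->
  exists2 C, 0 <= C & forall y,
    (\int[mu]_(x in `[(- M)%R, M]) (rieszk a x y)%:E <= C%:E)%E.
Proof.
move=> /andP[a0 a1] M0; pose b := 2 `^ a; pose q := b / 2.
have b0 : 0 < b by rewrite powR_gt0.
have q0 : 0 <= q by rewrite divr_ge0// ltW.
have q1 : q < 1.
  rewrite ltr_pdivrMr// mul1r /b /powR pnatr_eq0/= -[ltRHS]lnK ?posrE// ltr_expR.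
  by rewrite gtr_pMl// ln_gt0// ltr1n.
exists ((M + M) + 2 * b / (1 - q)) => [|y].
  by rewrite addr_ge0 ?addr_ge0// divr_ge0 ?mulr_ge0 ?subr_ge0// ltW.
have mD : measurable (`[(- M)%R, M]%classic : set R) by exact: measurable_itv.
have mg j D : measurable_fun D (dyadic_kernel a y j).
  by apply/measurable_EFinP; apply: measurable_funM.
have mS D : measurable_fun D (fun x => \sum_(0 <= j <oo) dyadic_kernel a y j x)%E.
  by apply: ge0_emeasurable_sum => // j x _ _; exact: dyadic_kernel_ge0.
have S0 x : (0 <= \sum_(0 <= j <oo) dyadic_kernel a y j x)%E.
  by apply: nneseries_ge0 => j _ _; exact: dyadic_kernel_ge0.
apply: (@le_trans _ _ (\int[mu]_(x in `[(- M)%R, M])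
    (1 + \sum_(0 <= j <oo) dyadic_kernel a y j x))%E).
  apply: ge0_le_integral => //.
  - by move=> x _; rewrite lee_fin rieszk_ge0.
  - by apply/measurable_EFinP; apply: measurable_funTS; exact: measurable_rieszk.
  - by apply: emeasurable_funD => //; exact: mS.
  - by move=> x _; exact: rieszk_le_dyadic.
rewrite ge0_integralD//; last exact: mS.
rewrite integral_nneseries//; last 2 first.
- by move=> j; exact: mg.
- by move=> j x _; exact: dyadic_kernel_ge0.
rewrite EFinD; apply: leeD.
  rewrite integral_cst// mul1e [X in (X <= _)%E]lebesgue_measure_itv/=.
  by case: ifP => _; rewrite -?EFinB ?lee_fin ?opprK// addr_ge0.
apply: lime_le.
  by apply: is_cvg_nneseries => j _ _; apply: integral_ge0 => x _; exact: dyadic_kernel_ge0.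
apply: nearW => n; apply: (@le_trans _ _ (\sum_(0 <= j < n) (2 * b * q ^+ j)%:E)%E).
  apply: lee_sum => j _; rewrite ge0_integralZl_EFin//; last exact/measurable_EFinP/measurable_indic.
  rewrite integral_indic//.
  apply: (@le_trans _ _ ((b ^+ j.+1)%:E * mu `[(y - 2^-1 ^+ j)%R, (y + 2^-1 ^+ j)%R])%E).
    apply: lee_wpmul2l; first by rewrite lee_fin exprn_ge0// ltW.
    by apply: le_measure; rewrite ?inE//; apply: measurableI.
  rewrite lebesgue_measure_itv/= lte_fin; case: ifP => _; last first.
    by rewrite mule0 lee_fin !mulr_ge0 ?exprn_ge0// ltW.
  rewrite -EFinB -EFinM lee_fin /q exprMn exprS.
  rewrite le_eqVlt; apply/orP; left; apply/eqP; rewrite -/b; ring.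
rewrite sumEFin lee_fin -mulr_sumr; apply: ler_wpM2l; first by rewrite mulr_ge0// ltW.
rewrite big_mkord -[leRHS]div1r ler_pdivlMr ?subr_gt0//.
have := subrX1 q n; have := exprn_ge0 n q0.
move: (q ^+ n) (\sum_(i < n) q ^+ i) => t s t0 e; nra.
Qed.

End kernel_integral.

(** * The majorant on a cube, integrated by Tonelli's theorem *)

Section majorant_integral.
Context {R : realType}.
Local Notation T := (measurableTypeR R).
Local Notation mu := (@lebesgue_measure R).

Lemma majorant_tupleE n a (t : n.-tuple R) : majorant a t =
  \prod_(i < n) (1 + \sum_(j < n | (i < j)%N) rieszk a (tnth t i) (tnth t j)).
Proof.
elim: n t => [|n IH] t; first by rewrite tuple0 big_ord0.
case/tupleP: t => x t; rewrite big_ord_recl /= IH; congr (_ * _).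
  congr (1 + _); rewrite [RHS]big_mkcond big_ord_recl /= add0r big_tuple.
  by apply: eq_bigr => j _; rewrite tnth0 tnthS.
apply: eq_bigr => i _; congr (1 + _); rewrite [RHS]big_mkcond big_ord_recl /= add0r.
by rewrite -big_mkcond; apply: eq_bigr => j _; rewrite !tnthS.
Qed.

Definition cube n (M : R) : set (n.-tuple T) :=
  [set t | forall i, `[(- M), M]%classic (tnth t i)].
Arguments cube n M : clear implicits.

Lemma measurable_cube n M : measurable (cube n M).
Proof. by apply: (@measurable_box R n (fun=> _)) => i; exact: measurable_itv. Qed.

Lemma measurable_majorant n a :
  measurable_fun [set: n.-tuple T] (fun t => majorant a t).
Proof.
rewrite (_ : (fun t => _) = (fun t : n.-tuple T => \prod_(i < n)
    (1 + \sum_(j < n | (i < j)%N) rieszk a (tnth t i) (tnth t j)))); last first.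
  by apply/funext => t; exact: majorant_tupleE.
apply: measurable_prod => i _; apply: measurable_funD => //.
rewrite (_ : (fun t => _) = (fun t : n.-tuple T =>
    \sum_(j < n) if (i < j)%N then rieszk a (tnth t i) (tnth t j) else 0)); last first.
  by apply/funext => t; rewrite big_mkcond.
apply: (measurable_sum _ (h := fun (j : 'I_n) (t : n.-tuple T) =>
  if (i < j)%N then rieszk a (tnth t i) (tnth t j) else 0)) => j.
case: (i < j)%N => //.
apply: (measurableT_comp (measurable_powR _)).
apply: measurableT_comp; first exact: normr_measurable.
by apply: measurable_funB; exact: measurable_tnth.
Qed.

(** The indicator of the cube is built in so that Tonelli's theorem applies on the whole product
    space. *)
Definition cube_majorant n (a M : R) (t : n.-tuple T) : R := majorant a t * \1_(cube n M) t.

Lemma cube_majorant_ge0 n a M t : 0 <= @cube_majorant n a M t.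
Proof. by rewrite mulr_ge0 ?majorant_ge0. Qed.

Lemma measurable_cube_majorant n a M : measurable_fun setT (@cube_majorant n a M).
Proof.
apply: measurable_funM; first exact: measurable_majorant.
by apply: measurable_indic; exact: measurable_cube.
Qed.

Lemma cube_majorant_cons n a M (x : T) (t : n.-tuple T) :
  cube_majorant a M (cons_pair (x, t)) =
  cube_majorant a M t * ((1 + \sum_(y <- t) rieszk a x y) * \1_(`[(- M), M]%classic : set T) x).
Proof.
rewrite /cube_majorant /= mulrACA [majorant _ _ * _]mulrC; congr (_ * _).
rewrite !indicE -natrM mulnb; congr (_%:R); congr nat_of_bool.
apply/idP/andP => [|[]]; rewrite !inE /cube /=.
  move=> H; split; first by move=> i; have := H (lift ord0 i); rewrite tnthS.
  by have := H ord0; rewrite tnth0.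
by move=> H xM i; have [j ->|->] := unliftP ord0 i; rewrite ?tnthS ?tnth0.
Qed.

(** Induction on the dimension: the measure is pushed forward from a product, and the head is
    integrated first with the tail fixed. Its integral is bounded uniformly in the tail, and what
    remains is the same integral in one dimension less. *)
Lemma integral_cube_majorant n (a M : R) : 0 <= a < 1 -> 0 <= M ->
  exists C : R, (\int[lebesgue_measure_tuple R n]_t (@cube_majorant n a M t)%:E <= C%:E)%E.
Proof.
move=> a01 M0; have [B B0 HB] := integral_rieszk_bounded a01 M0.
elim: n => [|n [C HC]].
  exists (cube_majorant a M [tuple]).
  have := @integral_dirac _ (0.-tuple T) ([tuple] : 0.-tuple T) R setT measurableT
    (fun t => (cube_majorant a M t)%:E).
  rewrite diracT mul1e => ->//.
  by apply/measurable_EFinP; exact: measurable_cube_majorant.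
(* The summand 1 contributes the length [M + M] of the interval, and each of the [n] kernels at most
   [B]. *)
pose D := M + M + n%:R * B.
exists (D * C).
have H1 : (\int[lebesgue_measure_tuple R n.+1]_t (cube_majorant a M t)%:E =
    \int[mu \x lebesgue_measure_tuple R n]_p (cube_majorant a M (cons_pair p))%:E)%E.
  have := @ge0_integral_pushforward _ _ _ _ R _ (measurable_cons_pair (n := n))
    (mu \x lebesgue_measure_tuple R n)%E setT (fun t => (cube_majorant a M t)%:E).
  rewrite preimage_setT; apply => //.
  - by apply/measurable_EFinP; exact: measurable_cube_majorant.
  - by move=> t _; rewrite lee_fin cube_majorant_ge0.
have mcm : measurable_fun setT (fun t : n.-tuple T => (cube_majorant a M t)%:E).
  by apply/measurable_EFinP; exact: measurable_cube_majorant.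
have mf : measurable_fun setT (fun p => (cube_majorant a M (@cons_pair R n p))%:E).
  apply/measurable_EFinP.
  by apply: (measurableT_comp (measurable_cube_majorant _ _)); exact: measurable_cons_pair.
have mI : measurable (`[(- M)%R, M]%classic : set T) by exact: measurable_itv.
have inner (t : n.-tuple T) :
    (\int[mu]_x ((1 + \sum_(y <- t) rieszk a x y) * \1_(`[(- M), M]%classic : set T) x)%:E
     <= D%:E)%E.
  rewrite (_ : (fun x => _) =
      ((fun x => 1 + \sum_(y <- t) (rieszk a x y)%:E)%E \_ `[(- M)%R, M])); last first.
    apply/funext => x; rewrite patchE indicE sumEFin; case: ifP => _.
      by rewrite mulr1.
    by rewrite mulr0.
  rewrite -integral_mkcond ge0_integralD//; last 2 first.
  - by move=> x _; apply: sume_ge0 => y _; rewrite lee_fin rieszk_ge0.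
  - apply: emeasurable_sum => y; apply/measurable_EFinP; apply: measurable_funTS.
    exact: measurable_rieszk.
  rewrite EFinD; apply: leeD.
    rewrite integral_cst// mul1e [X in (X <= _)%E]lebesgue_measure_itv/=.
    by case: ifP => _; rewrite -?EFinB ?lee_fin ?opprK// addr_ge0.
  rewrite ge0_integral_sum//; last 2 first.
  - move=> y; apply/measurable_EFinP; apply: measurable_funTS.
    exact: measurable_rieszk.
  - by move=> y x _; rewrite lee_fin rieszk_ge0.
  apply: (@le_trans _ _ (\sum_(y <- t) B%:E)%E); first by apply: lee_sum => y _; exact: HB.
  by rewrite sumEFin big_const_seq count_predT size_tuple iter_addr_0 mulr_natl.
rewrite H1 fubini_tonelli2//; last by move=> p; rewrite lee_fin cube_majorant_ge0.
have D0 : 0 <= D by rewrite addr_ge0 ?addr_ge0 ?mulr_ge0.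
apply: (@le_trans _ _ (\int[lebesgue_measure_tuple R n]_t (D%:E * (cube_majorant a M t)%:E))%E).
  apply: ge0_le_integral => //.
  - by move=> t _; apply: integral_ge0 => x _; rewrite lee_fin cube_majorant_ge0.
  - apply: measurable_fun_fubini_tonelli_G => // p.
    by rewrite lee_fin cube_majorant_ge0.
  - exact: measurable_funeM.
  move=> t _; rewrite /fubini_G.
  under eq_integral do rewrite cube_majorant_cons EFinM.
  rewrite ge0_integralZl_EFin//; last 3 first.
  - by move=> x _; rewrite lee_fin mulr_ge0// addr_ge0// sumr_ge0// => y _; exact: rieszk_ge0.
  - apply/measurable_EFinP; apply: measurable_funM; last exact: measurable_indic.
    apply: measurable_funD => //; apply: (measurable_sum _ (h := fun y x => rieszk a x y)) => y.
    exact: measurable_rieszk.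
  - exact: cube_majorant_ge0.
  by rewrite muleC lee_wpmul2r// lee_fin cube_majorant_ge0.
rewrite ge0_integralZl_EFin//.
  by rewrite EFinM lee_wpmul2l// lee_fin.
by move=> t _; rewrite lee_fin cube_majorant_ge0.
Qed.

End majorant_integral.
Arguments cube {R} n M.

(** * Measurability, neighbourhoods and the proof of the theorem *)

Section measurability.
Context {R : realType}.
Local Notation T := (measurableTypeR R).

Lemma normc_sqr (z : R[i]) : Normc.normc z ^+ 2 = complex.Re z ^+ 2 + complex.Im z ^+ 2.
Proof. by case: z => u v; rewrite /= sqr_sqrtr// addr_ge0 ?sqr_ge0. Qed.

Lemma measurable_normc_meval N (f : {mpoly R[i][N]}) :
  measurable_fun [set: N.-tuple T]
    (fun t => Normc.normc f.@[fun i => (tnth t i)%:C%C] ^+ 2).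
Proof.
pose mon m (t : N.-tuple T) : R := \prod_i tnth t i ^+ mpoly.fun_of_multinom m i.
pose part (p : R[i] -> R) (t : N.-tuple T) :=
  \sum_(m <- mpoly.msupp f) p (mpoly.mcoeff m f) * mon m t.
have mpart p : measurable_fun setT (part p).
  apply: (measurable_sum _ (h := fun m t => p (mpoly.mcoeff m f) * mon m t)) => m.
  apply: measurable_funM => //; apply: measurable_prod => i _.
  by apply: measurable_funX; exact: measurable_tnth.
(* At real points the real and imaginary parts of [f] are the real polynomials with the real and
   imaginary parts of its coefficients. *)
rewrite (_ : (fun t => _) = (fun t => part (@complex.Re R) t ^+ 2 + part (@complex.Im R) t ^+ 2)).
  by apply: measurable_funD; exact: measurable_funX.
apply/funext => t; rewrite normc_sqr mpoly.mevalE.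
have E m : \prod_i (tnth t i)%:C%C ^+ mpoly.fun_of_multinom m i = (mon m t)%:C%C :> R[i].
  rewrite /mon rmorph_prod; apply: eq_bigr => i _; by rewrite rmorphXn.
under eq_bigr do rewrite E.
by congr (_ ^+ 2 + _ ^+ 2); rewrite raddf_sum; apply: eq_bigr => m _;
  case: (mpoly.mcoeff m f) => u v /=; rewrite !(mulr0, subr0, add0r, addr0).
Qed.

Lemma measurable_normc_quotient N (c : R) (f : {mpoly R[i][N]}) :
  measurable_fun [set: N.-tuple T]
    (fun t => Normc.normc (vandermonde_quotient c f t) ^+ 2).
Proof.
under eq_fun do rewrite normc_vandermonde_quotient exprMn.
apply: measurable_funM; first exact: measurable_normc_meval.
rewrite (_ : (fun t => _) = (fun t : N.-tuple T => vdm (- c) (tnth t) ^+ 2)); last first.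
  apply/funext => t; congr (_ ^+ 2); rewrite /vdm -prodfV; apply: eq_bigr => i _.
  by rewrite -prodfV; apply: eq_bigr => j _; rewrite powRN.
apply: measurable_funX; apply: measurable_prod => i _.
rewrite (_ : (fun t => _) = (fun t : N.-tuple T =>
    \prod_(j < N) if (i < j)%N then `|tnth t i - tnth t j| `^ (- c) else 1)); last first.
  by apply/funext => t; rewrite big_mkcond.
apply: measurable_prod => j _; case: (i < j)%N => //.
apply: (measurableT_comp (measurable_powR _)).
apply: measurableT_comp; first exact: normr_measurable.
by apply: measurable_funB; exact: measurable_tnth.
Qed.

Lemma nbhs_cube N (a : N.-tuple R) : exists2 M, 0 <= M & nbhs a (cube N M).
Proof.
(* The unit ball about [a] lies in this cube; it is a neighbourhood because tuples carry the
   topology induced from row vectors. *)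
exists (1 + \sum_i `|tnth a i|) => [|]; first by rewrite addr_ge0// sumr_ge0.
pose w (t : N.-tuple R) : 'rV[R]_N := \row_i tnth t i.
have wc : continuous w by exact: initial_continuous.
have : nbhs a (w @^-1` ball (w a) 1) by apply: wc; exact: nbhsx_ballx.
apply: filterS => t wt i; rewrite /= in_itv /= -ler_norml.
have [_ /(_ ord0 i)] := wt; rewrite !mxE /ball /= => ati.
have h : `|tnth a i| <= \sum_i `|tnth a i|.
  by rewrite (bigD1 i)//= lerDl sumr_ge0.
rewrite -[tnth t i](subKr (tnth a i)); apply: le_trans (ler_normB _ _) _.
by lra.
Qed.

End measurability.

Theorem proposition5p1 (R : realType) (N k : nat) (c : R)
    (hN : (2 <= N)%N) (hk : (1 <= k <= N - 1)%N) (hc : c <= k.+1%:R^-1)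
    (f : {mpoly R[i][N]}) (hf : f \in equal_coord_ideal R[i] N k) :
  locally_L2 (vandermonde_quotient c f).
Proof.
move=> x; have [M M0 xM] := nbhs_cube x; exists (cube N M); split => //.
  exact: measurable_cube.
case: N hN hk f hf x xM => // n _ /andP[k0 _] f hf x _.
have [C C0 HC] := pointwise_bound M k0 hc hf.
(* The strict inequality is what makes the kernel locally integrable in one variable. *)
have a01 : 0 <= (k%:R / k.+1%:R : R) < 1.
  by rewrite divr_ge0//= ltr_pdivrMr// mul1r ltr_nat.
have [B HB] := @integral_cube_majorant R n.+1 _ _ a01 M0.
have mU := @measurable_cube R n.+1 M.
apply/integrableP; split.
  by apply/measurable_EFinP; apply: measurable_funTS; exact: measurable_normc_quotient.
have mcm : measurable_fun setT (fun t => (@cube_majorant R n.+1 (k%:R / k.+1%:R) M t)%:E).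
  by apply/measurable_EFinP; exact: measurable_cube_majorant.
apply: (@le_lt_trans _ _ (C * B)%:E); last exact: ltry.
apply: (@le_trans _ _ (\int[lebesgue_measure_tuple R n.+1]_(t in cube n.+1 M)
    (C%:E * (cube_majorant (k%:R / k.+1%:R) M t)%:E))%E).
  apply: ge0_le_integral => //.
  - apply: measurableT_comp => //.
    by apply/measurable_EFinP; apply: measurable_funTS; exact: measurable_normc_quotient.
  - by apply: measurable_funeM; exact: measurable_funTS.
  move=> t tU; rewrite abse_EFin lee_fin ger0_norm ?sqr_ge0//.
  rewrite /cube_majorant indicE mem_set// mulr1; apply: HC => i.
  by have := tU i; rewrite /= in_itv /= -ler_norml.
rewrite ge0_integralZl_EFin//; last 2 first.
- by move=> t _; rewrite lee_fin cube_majorant_ge0.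
- exact: measurable_funTS.
rewrite EFinM; apply: lee_wpmul2l; first by rewrite lee_fin.
apply: le_trans HB; apply: ge0_subset_integral => //.
by move=> t _; rewrite lee_fin cube_majorant_ge0.
Qed.
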